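(* There exists a constant $c>0$ such that for all integers $q\ge 2$, $n\ge 1$ and $1\le t\le n$ and for all $N$ such that $N$ is a multiple of $q^t$ and $\min(N,q^n-N)\ge\left(\frac{cqn}{t}\right)^{ct}$, the number of orthogonal arrays $T$ of alphabet size $q$, length $n$, strength $t$ and with $|T|=N$ equals $$\frac{q^{-\frac12 n\binom{n-1}{t}(q-1)^t}}{(2\pi p(1-p))^{\frac12\sum_{i=0}^t\binom{n}{i}(q-1)^i}\,p^N(1-p)^{q^n-N}}\,(1+\delta),$$ where $p:=\frac{N}{q^n}$ and $$|\delta|\le\frac{\left(\frac{cqn}{t}\right)^{ct}}{\sqrt{\min(N,q^n-N)}}.$$
   Context: Write $[m]:=\{1,\ldots,m\}$. A subset $T\subset[q]^n$ is an orthogonal array of alphabet size $q$, length $n$ and strength $t$ if for any distinct indices $i_1,\ldots,i_t\in[n]$ and any (not necessarily distinct) values $v_1,\ldots,v_t\in[q]$, $$\left|\{x\in T:\ x_{i_1}=v_1,\ldots,x_{i_t}=v_t\}\right| = q^{-t}|T|.$$ The constant $c$ does not depend on any of the other parameters. *)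

(* Defs.v *)
From mathcomp Require Import all_boot all_order all_algebra.
From mathcomp Require Import all_classical all_reals all_analysis.
Set Implicit Arguments.
Unset Strict Implicit.
Unset Printing Implicit Defensive.
Import Order.TTheory GRing.Theory Num.Theory.
Local Open Scope ring_scope.

(* The alphabet [q] and the index sets [n], [t] are the ordinals 'I_q, 'I_n,
   'I_t; a word x in [q]^n is a finite function. *)
Definition orthogonal_array (q n t : nat) (T : {set {ffun 'I_n -> 'I_q}}) :
    bool :=
  [forall i : {ffun 'I_t -> 'I_n}, injectiveb i ==>
    [forall v : {ffun 'I_t -> 'I_q},
      (#|[set x in T | [forall j : 'I_t, x (i j) == v j]]|%:R : rat)
        == q%:R ^- t * #|T|%:R]].

Definition num_orthogonal_arrays (q n t N : nat) : nat :=
  #|[set T : {set {ffun 'I_n -> 'I_q}} |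
      orthogonal_array t T && (#|T| == N)]|.

(* Main.v *)
Require Import Defs.
From mathcomp Require Import all_boot all_order all_algebra.
From mathcomp Require Import all_classical all_reals all_analysis.
From mathcomp Require Import complex ring lra zify.
Import Order.TTheory GRing.Theory Num.Theory.
Import numFieldNormedType.Exports.
Set Implicit Arguments.
Unset Strict Implicit.
Unset Printing Implicit Defensive.
Local Open Scope ring_scope.

(** The count is a local limit theorem.  Put every word independently into a
random set T with probability p = N / q ^ n.  Each set of size N has the same
weight p ^ N * (1 - p) ^ (q ^ n - N), so the number of arrays is the probability
that T is an array with N elements, divided by that weight.

For a word w with at most t nonzero letters let f_w be the indicator of the
words that agree with w wherever w is nonzero.  These functions are a basis of
the functions of degree at most t, and T is an array with N elements iff for
every such w the sum of f_w over T equals its mean (hit_orthogonal_array).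
Fourier inversion turns this event, for an integer vector indexed by the words
w, into an average over a torus of the characteristic function, a product over
the words x of the factors psi p (2 pi L x), where L is the combination of the
f_w given by the frequency th.  Instead of integrals there are sums over a grid
of mesh 1 / M (prob_hitE), which are exact for every large M.

Near the origin the product is compared with a gaussian in th (near_bound);
far from it both are negligible (far_chf, far_gauss).  Two facts on functions of
degree at most t make the errors polynomial in q, n / t to the power t:

- a value of L, or a coefficient of L, is a combination with integer
  coefficients of values of L at points each of which is nearly uniformly
  distributed, so any even subadditive function on the reals, such as the
  absolute value or |sin (pi .)|, which measures the distance to the integers,
  is bounded at every value of L by a multiple of its mean over all values
  (seminorm_lin, seminorm_coef);

- the sum of L ^ 2 over the words is a sum of squares with weights
  word_sqnorm u of coordinates that depend on th in a unitriangular way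
  (lin_sqr), because the f_w can be orthogonalised letter by letter.  Hence the
  gaussian sum is evaluated one variable at a time (tri_sum_le, tri_sum_ge),
  each step being a Riemann sum for the one-dimensional gaussian integral, and
  the determinant is the product of the weights, a power of q
  (prod_word_sqnorm).

The resulting estimate is local_limit; its polynomial error is absorbed by the
constant of the theorem in threshold_bound. *)

(** * Riemann sums of the one-dimensional gaussian *)

Section GaussSum.
Context {R : realType}.
Let mu := @lebesgue_measure R.

Definition gauss_prim (x : R) : R := \int[mu]_(t in `]-oo, x]) gauss_fun t.

Lemma integrable_gauss (A : set R) : measurable A -> mu.-integrable A (EFin \o gauss_fun).
Proof. by move=> mA; apply: integrableS (@integrableT_gauss R). Qed.

Lemma gauss_primB (x y : R) : x <= y ->
  gauss_prim y - gauss_prim x = \int[mu]_(t in `]x, y]) gauss_fun t.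
Proof.
move=> xy; apply: (@Rintegral_itvB _ _ -oo%O (BRight y)) => //.
exact: integrable_gauss.
Qed.

Lemma is_derive_gauss_prim (x : R) : is_derive x 1 gauss_prim (gauss_fun x).
Proof.
have [] := @continuous_FTC1 _ gauss_fun -oo%O x (x + 1) _ _ _ _.
- by rewrite ltrDl.
- exact: integrable_gauss.
- exact: ltNyr.
- exact: continuous_gauss_fun.
move=> h1 h2; apply: DeriveDef; first exact: h1.
by rewrite -derive1E; exact: h2.
Qed.

Lemma gauss_prim_MVT (x y : R) : x <= y ->
  exists2 z, x <= z <= y & gauss_prim y - gauss_prim x = gauss_fun z * (y - x).
Proof.
move=> xy.
have [z zxy ->] := @MVT_segment _ gauss_prim gauss_fun x y xy
  (fun z _ => is_derive_gauss_prim z)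
  (derivable_within_continuous (fun z _ => @ex_derive _ _ _ _ _ _ _ (is_derive_gauss_prim z))).
by exists z => //; rewrite in_itv in zxy.
Qed.

Lemma gauss_primB_le (x y : R) : x <= y -> gauss_prim y - gauss_prim x <= Num.sqrt pi.
Proof.
move=> xy; rewrite gauss_primB //.
have -> : Num.sqrt pi = \int[mu]_t (@gauss_fun R t).
  by rewrite /Rintegral /mu integralT_gauss.
rewrite /Rintegral fine_le//.
- by apply: integrable_fin_num => //; exact: integrable_gauss.
- by apply: integrable_fin_num => //; exact: integrable_gauss.
apply: ge0_subset_integral => //.
- by apply/measurable_realfun.measurable_EFinP; exact: measurable_gauss_fun.
- by move=> t _; rewrite lee_fin gauss_fun_ge0.
Qed.

(** The derivative of the sum of the primitive and of its reflection vanishes,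
the gaussian being even. *)
Lemma gauss_prim_sym (x : R) : 0 <= x ->
  gauss_prim x - gauss_prim 0 = gauss_prim 0 - gauss_prim (- x).
Proof.
move=> x0.
have dd (z : R) : is_derive z 1 (fun y => gauss_prim y + gauss_prim (- y)) 0.
  have h1 : is_derive z 1 (fun y => gauss_prim (- y)) (- gauss_fun z).
    have -> : - gauss_fun z = gauss_fun (- z) * -1 :> R.
      by rewrite /gauss_fun sqrrN mulrN1.
    apply: (@is_derive1_comp _ gauss_prim (-%R)); exact: is_derive_gauss_prim.
  rewrite -(subrr (gauss_fun z)); apply: is_deriveD; exact: is_derive_gauss_prim.
have [z _] := @MVT_segment _ _ (fun=> 0) 0 x x0 (fun z _ => dd z)
  (derivable_within_continuous (fun z _ => @ex_derive _ _ _ _ _ _ _ (dd z))).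
rewrite mul0r oppr0 => /eqP; rewrite subr_eq0 => /eqP; lra.
Qed.

Lemma gauss_prim_cvg (e : R) : 0 < e ->
  exists2 T, 0 < T & (1 - e) * Num.sqrt pi <= gauss_prim T - gauss_prim (- T).
Proof.
move=> e0.
have sp : 0 < Num.sqrt (pi : R) by rewrite sqrtr_gt0 pi_gt0.
have := @ge0_cvgn_integral R mu gauss_fun (@gauss_fun_ge0 R)
  (@measurable_gauss_fun R).
rewrite integral0y_gauss.
move=> /fine_cvgP [_] /cvgrPdist_lt /(_ (e * (Num.sqrt pi / 2))).
move=> /(_ (mulr_gt0 e0 (divr_gt0 sp (ltr0Sn _ _)))) [N _ hN].
exists N.+1%:R; first by [].
have := hN N.+1 (leqnSn _) => /=; rewrite -/(Rintegral _ _ _).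
rewrite -Rintegral_itv_obnd_cbnd; last exact: integrable_gauss.
rewrite -gauss_primB // => /(le_lt_trans (ler_norm _)) h.
have := @gauss_prim_sym N.+1%:R (ler0n _ _); lra.
Qed.

(** The total variation of the gaussian up to a point, normalised to vanish at
0: increasing before 0, decreasing after. *)
Definition gauss_var (x : R) : R := if 0 <= x then 1 - gauss_fun x else gauss_fun x - 1.

Lemma gauss_var_bound (x : R) : -1 <= gauss_var x <= 1.
Proof.
rewrite /gauss_var; have := gauss_fun_ge0 x; have := gauss_fun_le1 x.
by case: ifP => _ h1 h2; apply/andP; split; lra.
Qed.

Lemma gauss_varP (x y : R) : x <= y -> `|gauss_fun x - gauss_fun y| <= gauss_var y - gauss_var x.
Proof.
move=> xy; rewrite /gauss_var.
have := gauss_fun_le1 x; have := gauss_fun_le1 y.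
case: ifP => y0; case: ifP => x0 hy hx; rewrite ler_norml.
- suff : gauss_fun y <= gauss_fun x by move=> h; apply/andP; split; lra.
  by rewrite ler_expR lerN2 lerXn2r// ?nnegrE.
- by apply/andP; split; lra.
- by move: y0; rewrite (le_trans x0 xy).
- suff : gauss_fun x <= gauss_fun y by move=> h; apply/andP; split; lra.
  rewrite ler_expR lerN2 -(sqrrN y) -(sqrrN x) lerXn2r// ?nnegrE ?lerN2 // oppr_ge0.
    by move/negbT: y0; rewrite -ltNge => /ltW.
  by move/negbT: x0; rewrite -ltNge => /ltW.
Qed.

(** By the mean value theorem the integral over a step is a value of the
gaussian times the step, and two values on the step differ by at most the
variation over it. *)
Lemma gauss_step (h x : R) : 0 <= h ->
  `|h * gauss_fun x - (gauss_prim (x + h) - gauss_prim x)|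
   <= h * (gauss_var (x + h) - gauss_var x).
Proof.
move=> h0; have xh : x <= x + h by rewrite lerDl.
have [z /andP[xz zh] ->] := gauss_prim_MVT xh.
have -> : x + h - x = h by ring.
rewrite (mulrC _ h) -mulrBr normrM ger0_norm// ler_wpM2l//.
apply: (le_trans (gauss_varP xz)); rewrite lerD2r.
by rewrite -subr_ge0; apply: le_trans (gauss_varP zh); exact: normr_ge0.
Qed.

(** The errors of the steps telescope to the total variation, which is at most
2, wherever the grid lies. This uniformity in the shift s is what allows to sum
one variable after the other in several dimensions. *)
Lemma gauss_sum (h s : R) (n : nat) : 0 <= h ->
  `|\sum_(k < n) h * gauss_fun (s + k%:R * h)
     - (gauss_prim (s + n%:R * h) - gauss_prim s)| <= 2 * h.
Proof.
move=> h0.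
suff H : `|\sum_(k < n) h * gauss_fun (s + k%:R * h)
     - (gauss_prim (s + n%:R * h) - gauss_prim s)|
     <= h * (gauss_var (s + n%:R * h) - gauss_var s).
  apply: (le_trans H); rewrite mulrC ler_wpM2r//.
  have /andP[] := gauss_var_bound (s + n%:R * h).
  have /andP[] := gauss_var_bound s; lra.
elim: n => [|n IH]; first by rewrite big_ord0 mul0r addr0 !subrr normr0 mulr0.
have e : s + n.+1%:R * h = s + n%:R * h + h by rewrite -natr1; ring.
rewrite big_ord_recr/= e.
have := gauss_step (s + n%:R * h) h0.
set a := gauss_prim (_ + _ + h); set b := gauss_prim (s + _) in IH *.
set c := gauss_var (_ + _ + h); set d := gauss_var (s + _) in IH *.
move: IH; rewrite !ler_norml => /andP[? ?] /andP[? ?]; apply/andP; split; lra.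
Qed.
End GaussSum.

Section GaussGrid1.
Context {R : realType}.

Lemma sqrtpi_ge1 : 1 <= Num.sqrt (pi : R).
Proof. by rewrite -[leLHS]sqrtr1 ler_sqrt ?pi_gt0 // (le_trans _ (pi_ge2 R))// ler1n. Qed.

Lemma gauss_fun_scale (a x : R) : 0 < a -> expR (- (a * x ^+ 2)) = gauss_fun (Num.sqrt a * x).
Proof. by move=> a0; rewrite /gauss_fun exprMn sqr_sqrtr// ltW. Qed.

Lemma gauss_grid1_le (a M s e : R) (n : nat) : 0 < a -> 0 < M ->
  2 * Num.sqrt a / M <= e ->
  M^-1 * (\sum_(k < n) expR (- (a * (k%:R / M + s) ^+ 2)))
    <= (1 + e) * Num.sqrt (pi / a).
Proof.
move=> a0 M0 he; have sa : 0 < Num.sqrt a by rewrite sqrtr_gt0.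
have h0 : 0 <= Num.sqrt a / M by rewrite divr_ge0 ?ltW.
have := gauss_sum (Num.sqrt a * s) n h0.
have -> : \sum_(k < n) Num.sqrt a / M * gauss_fun (Num.sqrt a * s + k%:R * (Num.sqrt a / M))
   = Num.sqrt a * (M^-1 * \sum_(k < n) expR (- (a * (k%:R / M + s) ^+ 2))).
  rewrite mulrA mulr_sumr; apply: eq_bigr => k _; rewrite gauss_fun_scale //.
  by congr (_ * gauss_fun _); ring.
have hle : Num.sqrt a * s <= Num.sqrt a * s + n%:R * (Num.sqrt a / M).
  by rewrite lerDl mulr_ge0 // ler0n.
move=> /(le_trans (ler_norm _)) h2.
have h1 := gauss_primB_le hle.
rewrite sqrtrM ?pi_ge0 // sqrtrV ?(ltW a0) // [leRHS]mulrA ler_pdivlMr // mulrC.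
apply: (@le_trans _ _ (Num.sqrt pi + 2 * (Num.sqrt a / M))); first by lra.
have := sqrtpi_ge1; nra.
Qed.

Lemma gauss_prim_le (x y : R) : x <= y -> gauss_prim x <= gauss_prim y.
Proof.
move=> xy; have [z _ h] := gauss_prim_MVT xy.
by rewrite -subr_ge0 h mulr_ge0 ?gauss_fun_ge0 ?subr_ge0.
Qed.

Lemma gauss_prim_lip (x y : R) : x <= y -> gauss_prim y - gauss_prim x <= y - x.
Proof.
move=> xy; have [z _ ->] := gauss_prim_MVT xy.
by rewrite ler_piMl ?gauss_fun_le1 ?subr_ge0.
Qed.

(** The points of the grid in the window [- T, T] form a run of consecutive
indices; its ends miss those of the window by less than a step, which costs the
third h. *)
Lemma gauss_trunc_sum (T h s : R) (n : nat) : 0 < h -> h <= T -> s <= - T -> T < s + n%:R * h ->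
  gauss_prim T - gauss_prim (- T) - 3 * h <=
  h * \sum_(k < n | `|s + k%:R * h| <= T) gauss_fun (s + k%:R * h).
Proof.
move=> h0 hT sT Tn.
have x0 : 0 <= (- T - s) / h by apply: divr_ge0; [lra | exact: ltW].
pose k1 := (Num.truncn ((- T - s) / h)).+1.
have [a1 a2] : - T < s + k1%:R * h /\ s + k1%:R * h <= - T + h.
  have /andP[] := truncn_itv x0; rewrite -/k1 ler_pdivlMr // ltr_pdivrMr // => b1 b2.
  have e1 : (k1%:R : R) = (Num.truncn ((- T - s) / h))%:R + 1 by rewrite natr1.
  move: b1 b2; rewrite e1; move: (Num.truncn _)%:R => c b1 b2.
  by split; lra.
have y0 : 0 <= (T - (s + k1%:R * h)) / h by apply: divr_ge0; [lra | exact: ltW].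
pose n1 := (Num.truncn ((T - (s + k1%:R * h)) / h)).+1.
have [a3 a4] : T < s + k1%:R * h + n1%:R * h /\ s + k1%:R * h + n1%:R * h <= T + h.
  have /andP[] := truncn_itv y0; rewrite -/n1 ler_pdivlMr // ltr_pdivrMr // => b1 b2.
  have e1 : (n1%:R : R) = (Num.truncn ((T - (s + k1%:R * h)) / h))%:R + 1 by rewrite natr1.
  move: b1 b2; rewrite e1; move: (Num.truncn _)%:R => c b1 b2.
  by split; lra.
have kn : (k1 + n1 <= n)%N.
  rewrite leqNgt; apply/negP => le.
  have : (n.+1%:R : R) <= (k1 + n1)%:R by rewrite ler_nat.
  rewrite natrD -natr1 => le'.
  have : (n%:R + 1) * h <= (k1%:R + n1%:R) * h by rewrite ler_pM2r.
  by rewrite !mulrDl mul1r => le2; lra.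
have : h * \sum_(j < n1) gauss_fun ((s + k1%:R * h) + j%:R * h) <=
   h * \sum_(k < n | `|s + k%:R * h| <= T) gauss_fun (s + k%:R * h).
  rewrite ler_pM2l // -(big_mkord xpredT (fun j => gauss_fun (s + k1%:R * h + j%:R * h))).
  rewrite -(big_mkord (fun k => `|s + k%:R * h| <= T) (fun k => gauss_fun (s + k%:R * h))).
  have k1n : (k1 <= n)%N by rewrite (leq_trans _ kn) // leq_addr.
  rewrite (big_cat_nat (leq0n k1) k1n) /=.
  rewrite (big_cat_nat (leq_addr n1 k1) kn) /=.
  rewrite -{3}[k1]add0n big_addn addKn.
  apply: (@le_trans _ _ (\sum_(0 <= i < n1 | `|s + (i + k1)%:R * h| <= T)
       gauss_fun (s + (i + k1)%:R * h))); last first.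
    by rewrite addrCA lerDl addr_ge0 // sumr_ge0 // => i _; exact: gauss_fun_ge0.
  rewrite !big_mkord [leRHS]big_mkcond /=; apply: ler_sum => i _.
  have ii : (i%:R : R) + 1 <= n1%:R by rewrite natr1 ler_nat.
  have i0 : 0 <= (i%:R : R) * h by rewrite mulr_ge0 // ltW.
  have : (i%:R + 1) * h <= n1%:R * h by rewrite ler_pM2r.
  rewrite mulrDl mul1r => ih.
  have -> : s + (i + k1)%:R * h = s + k1%:R * h + i%:R * h by rewrite natrD; ring.
  by rewrite ler_norml; case: ifP => // /negbT /negP; case; apply/andP; split; lra.
apply: le_trans.
rewrite mulr_sumr; have := gauss_sum (s + k1%:R * h) n1 (ltW h0).
rewrite ler_norml => /andP[+ _].
have := gauss_prim_le (ltW a3).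
have : gauss_prim (s + k1%:R * h) <= gauss_prim (- T + h) by apply: gauss_prim_le.
have : gauss_prim (- T + h) - gauss_prim (- T) <= h.
  have -> : h = - T + h - - T by ring.
  by rewrite [in X in gauss_prim X](_ : - T + (- T + h - - T) = - T + h) ?gauss_prim_lip //; lra.
lra.
Qed.

(** The summand is cut off outside the window so that the bound depends only on
the grid covering the window. *)
Lemma gauss_grid1_ge (a T M s e : R) (n : nat) : 0 < a -> 0 < M -> 0 < e ->
  gauss_prim (Num.sqrt a * T) - gauss_prim (- (Num.sqrt a * T)) >= (1 - e / 2) * Num.sqrt pi ->
  6 * (Num.sqrt a / M) <= e -> M^-1 <= T -> s <= - T -> T < n%:R / M + s ->
  (1 - e) * Num.sqrt (pi / a) <=
  M^-1 * (\sum_(k < n) if `|k%:R / M + s| <= T then expR (- (a * (k%:R / M + s) ^+ 2)) else 0).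
Proof.
move=> a0 M0 e0 hT he MT sT Tn; have sa : 0 < Num.sqrt a by rewrite sqrtr_gt0.
have h0 : 0 < Num.sqrt a / M by rewrite divr_gt0.
have := @gauss_trunc_sum (Num.sqrt a * T) (Num.sqrt a / M) (Num.sqrt a * s) n h0.
rewrite ler_pM2l // -mulrN ler_pM2l // mulrCA -mulrDr ltr_pM2l // addrC => /(_ MT sT Tn).
rewrite mulrN [X in _ - X <= _]mulrC.
set S1 := \sum_(k < n | _) _; set S2 := \sum_(k < n) _.
have -> : S1 = S2.
  rewrite /S1 /S2 big_mkcond /=; apply: eq_bigr => k _.
  have -> : Num.sqrt a * s + k%:R * (Num.sqrt a / M) = Num.sqrt a * (k%:R / M + s) by ring.
  rewrite normrM (gtr0_norm sa) ler_pM2l //.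
  by rewrite gauss_fun_scale.
move=> h.
rewrite sqrtrM ?pi_ge0 // sqrtrV ?(ltW a0) // mulrA ler_pdivrMr // mulrAC [leRHS]mulrC mulrA.
have := sqrtpi_ge1.
move: h hT; set F := gauss_prim _; set G := gauss_prim _; rewrite [_ * 3]mulrC.
nra.
Qed.
End GaussGrid1.

(** * Sums of products in unitriangular coordinates *)

Section Triangular.
Context {R : realType}.
Variables (I K : finType) (val : K -> R) (k0 : K) (rho : I -> nat) (C : I -> I -> R).

Definition tri_shift (th : {ffun I -> K}) (i : I) : R :=
  \sum_(j | (rho j < rho i)%N) C i j * val (th j).
Definition tri_coord (th : {ffun I -> K}) (i : I) : R := val (th i) + tri_shift th i.

Definition upd (th : {ffun I -> K}) (a : I) (k : K) : {ffun I -> K} :=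
  [ffun i => if i == a then k else th i].

(** Vectors supported on A; sums over them are peeled off one index of A at a
time. *)
Definition frozen (A : {set I}) (th : {ffun I -> K}) : bool :=
  [forall j, (j \notin A) ==> (th j == k0)].

Lemma tri_shift_upd (th : {ffun I -> K}) a k i : (rho i <= rho a)%N ->
  tri_shift (upd th a k) i = tri_shift th i.
Proof.
move=> ia; apply: eq_bigr => j ji; rewrite ffunE; case: eqP => // ja.
by move: ji; rewrite ja ltnNge ia.
Qed.

Lemma tri_coord_upd (th : {ffun I -> K}) a k i : (rho i <= rho a)%N -> i != a ->
  tri_coord (upd th a k) i = tri_coord th i.
Proof. by move=> ia na; rewrite /tri_coord tri_shift_upd // ffunE (negbTE na). Qed.

(** The variable of maximal rank a enters no coordinate of A but its own, where
the others act as a shift; so it can be summed first. *)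
Lemma tri_peel (g : I -> R -> R) (A : {set I}) (a : I) :
  a \in A -> (forall i, i \in A -> (rho i <= rho a)%N) ->
  \sum_(th | frozen A th) \prod_(i in A) g i (tri_coord th i) =
  \sum_(th | frozen (A :\ a) th)
     (\prod_(i in A :\ a) g i (tri_coord th i)) * \sum_k g a (val k + tri_shift th a).
Proof.
move=> aA amax.
rewrite (partition_big (fun th => upd th a k0) (frozen (A :\ a))) /=; last first.
  move=> th /forallP fth; apply/forallP => j; apply/implyP; rewrite !inE negb_and negbK ffunE.
  by case: eqP => //= _ jA; have := fth j; rewrite jA.
apply: eq_bigr => th fth.
rewrite (reindex_onto (fun k => upd th a k) (fun th' => th' a)) /=; last first.
  move=> th' /andP[_ /eqP <-]; apply/ffunP => i; rewrite !ffunE.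
  by case: eqP => [->|].
have tha : th a = k0.
  by move/forallP: fth => /(_ a); rewrite !inE eqxx /= => /eqP.
rewrite mulr_sumr; apply: eq_big => [k|k _].
  rewrite ffunE eqxx eqxx andbT; apply/andP; split.
    apply/forallP => j; apply/implyP => jA; rewrite ffunE; case: (eqVneq j a) => [ja|ja].
      by move: jA; rewrite ja aA.
    by move/forallP: fth => /(_ j); rewrite !inE negb_and jA orbT.
  apply/eqP/ffunP => i; rewrite !ffunE; case: eqP => // ->; by rewrite tha.
rewrite (bigD1 a) //= mulrC; congr (_ * _).
  apply: eq_big => [i|i /andP[iA ia]]; first by rewrite !inE andbC.
  by rewrite tri_coord_upd // amax.
by rewrite /tri_coord tri_shift_upd // ffunE eqxx.
Qed.

Lemma frozen0 th : frozen finset.set0 th = (th == [ffun=> k0]).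
Proof.
apply/forallP/eqP => [h|-> j]; last by rewrite ffunE eqxx implybT.
by apply/ffunP => j; have := h j; rewrite inE ffunE => /eqP.
Qed.

Lemma frozenT th : frozen finset.setT th.
Proof. by apply/forallP => j; rewrite inE. Qed.

Lemma exists_rho_max (A : {set I}) : A != finset.set0 ->
  exists2 a, a \in A & forall i, i \in A -> (rho i <= rho a)%N.
Proof.
move=> /set0Pn [x xA]; have [a aA amax] := @arg_maxnP _ x (mem A) rho xA.
by exists a => // i iA; apply: amax.
Qed.

Lemma tri_sum_le (g : I -> R -> R) (b : I -> R) :
  (forall i y, 0 <= g i y) -> (forall i s, \sum_k g i (val k + s) <= b i) ->
  \sum_th \prod_i g i (tri_coord th i) <= \prod_i b i.
Proof.
move=> g0 gb.
have b0 i : 0 <= b i by apply: le_trans (gb i 0); apply: sumr_ge0.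
suff H (m : nat) (A : {set I}) : #|A| = m ->
    \sum_(th | frozen A th) \prod_(i in A) g i (tri_coord th i) <= \prod_(i in A) b i.
  have := H _ finset.setT erefl; rewrite (eq_bigl _ _ frozenT).
  rewrite [X in _ <= X -> _](eq_bigl xpredT); last by move=> i; rewrite inE.
  apply: le_trans; rewrite le_eqVlt; apply/orP; left; apply/eqP.
  by apply: eq_bigr => th _; apply: eq_bigl => i; rewrite inE.
elim: m A => [|m IH] A Am.
  move/eqP: Am; rewrite cards_eq0 => /eqP ->.
  rewrite (eq_bigl _ _ frozen0) big_pred1_eq !big1 //; by move=> i; rewrite inE.
have /exists_rho_max [a aA amax] : A != finset.set0 by rewrite -cards_eq0 Am.
rewrite (tri_peel g aA amax) [leRHS](bigD1 a) //= mulrC.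
rewrite (eq_bigl (mem (A :\ a))); last by move=> i; rewrite !inE andbC.
apply: le_trans (ler_wpM2r (b0 a) (IH (A :\ a) _)); last first.
  by move: Am; rewrite (cardsD1 a) aA => -[].
rewrite mulr_suml; apply: ler_sum => th _; apply: ler_wpM2l; last exact: gb.
exact: prodr_ge0.
Qed.

(** With cut-off factors a nonzero product bounds all coordinates by T, hence
all variables by induction on the rank; this bounds the shifts met on the way,
so that b is needed only for bounded shifts. *)
Lemma tri_sum_ge (g : I -> R -> R) (b : I -> R) (T c : R) (P : nat) :
  val k0 = 0 -> 0 <= T -> 0 <= c ->
  (forall i y, 0 <= g i y) -> (forall i y, T < `|y| -> g i y = 0) ->
  (forall i, (rho i <= P)%N) -> (forall i, \sum_j `|C i j| <= c) ->
  (forall i, 0 <= b i) ->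
  (forall i s, `|s| <= c * (T * (1 + c) ^+ P.+1) -> b i <= \sum_k g i (val k + s)) ->
  \prod_i b i <= \sum_th \prod_i g i (tri_coord th i).
Proof.
move=> v0 T0 c0 g0 gT rP Cc b0 gb.
have c1 : 1 <= 1 + c by rewrite lerDl.
have bnd (A : {set I}) th : frozen A th -> (forall i, i \in A -> `|tri_coord th i| <= T) ->
   forall m i, (rho i <= m)%N -> `|val (th i)| <= T * (1 + c) ^+ m.+1.
  move=> fA hA m; elim: m => [|m IH] i im; case: (boolP (i \in A)) => iA.
  - have := hA i iA; rewrite /tri_coord /tri_shift big1 ?addr0 => [|j].
      by move=> /le_trans; apply; rewrite expr1 ler_peMr.
    by rewrite ltnNge (leq_trans im).
  - by move/forallP: fA => /(_ i); rewrite iA => /eqP ->; rewrite v0 normr0 mulr_ge0 ?exprn_ge0 ?addr_ge0.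
  - have -> : val (th i) = tri_coord th i - tri_shift th i by rewrite /tri_coord addrK.
    apply: (le_trans (ler_normB _ _)).
    have hs : `|tri_shift th i| <= c * (T * (1 + c) ^+ m.+1).
      apply: (le_trans (ler_norm_sum _ _ _)).
      apply: (@le_trans _ _ (\sum_(j | (rho j < rho i)%N) `|C i j| * (T * (1 + c) ^+ m.+1))).
        apply: ler_sum => j ji; rewrite normrM ler_wpM2l // IH // -ltnS; exact: leq_trans ji im.
      rewrite -mulr_suml ler_wpM2r ?mulr_ge0 ?exprn_ge0 ?addr_ge0 //.
      apply: le_trans (Cc i); rewrite [leRHS](bigID (fun j => (rho j < rho i)%N)) /= lerDl.
      exact: sumr_ge0.
    have h1 : T <= T * (1 + c) ^+ m.+1 by rewrite ler_peMr // exprn_ege1.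
    rewrite [X in _ <= T * X]exprS; have := hA i iA; nra.
  - by move/forallP: fA => /(_ i); rewrite iA => /eqP ->; rewrite v0 normr0 mulr_ge0 ?exprn_ge0 ?addr_ge0.
suff H (m : nat) (A : {set I}) : #|A| = m ->
    \prod_(i in A) b i <= \sum_(th | frozen A th) \prod_(i in A) g i (tri_coord th i).
  have := H _ finset.setT erefl; rewrite (eq_bigl _ _ frozenT).
  rewrite [X in X <= _ -> _](eq_bigl xpredT); last by move=> i; rewrite inE.
  move=> /le_trans; apply; rewrite le_eqVlt; apply/orP; left; apply/eqP.
  by apply: eq_bigr => th _; apply: eq_bigl => i; rewrite inE.
elim: m A => [|m IH] A Am.
  move/eqP: Am; rewrite cards_eq0 => /eqP ->.
  rewrite (eq_bigl _ _ frozen0) big_pred1_eq !big1 //; by move=> i; rewrite inE.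
have /exists_rho_max [a aA amax] : A != finset.set0 by rewrite -cards_eq0 Am.
rewrite (tri_peel g aA amax) [leLHS](bigD1 a) //= mulrC.
rewrite (eq_bigl (mem (A :\ a))); last by move=> i; rewrite !inE andbC.
apply: (le_trans (ler_wpM2r (b0 a) (IH (A :\ a) _))).
  by move: Am; rewrite (cardsD1 a) aA => -[].
rewrite mulr_suml; apply: ler_sum => th fth.
case: (boolP [forall i in A :\ a, `|tri_coord th i| <= T]) => [/forall_inP hT|].
  apply: ler_wpM2l; first exact: prodr_ge0.
  apply: gb; apply: (le_trans (ler_norm_sum _ _ _)).
  apply: (@le_trans _ _ (\sum_(j | (rho j < rho a)%N) `|C a j| * (T * (1 + c) ^+ P.+1))).
    by apply: ler_sum => j ji; rewrite normrM ler_wpM2l //; apply: (bnd _ _ fth hT); exact: rP.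
  rewrite -mulr_suml ler_wpM2r ?mulr_ge0 ?exprn_ge0 ?addr_ge0 //.
  apply: le_trans (Cc a); rewrite [leRHS](bigID (fun j => (rho j < rho a)%N)) /= lerDl.
  exact: sumr_ge0.
rewrite negb_forall_in => /exists_inP [i iA]; rewrite -ltNge => hi.
by rewrite (bigD1 i) //= gT // !mul0r.
Qed.

End Triangular.

(** * Gaussian sums over a grid *)

Section GaussGrid.
Context {R : realType}.

(** The grid has mesh 1 / (2 m + 1), the mesh of Fourier inversion, and extends
from - m' to m' steps. Taking m' larger than m leaves the unit cube, which is
needed for the lower bound on gaussian sums. *)
Definition grid_val (m m' : nat) (k : 'I_(m'.*2.+1)) : R :=
  (k%:R - m'%:R) / (m.*2.+1)%:R.

(** Fine and wide enough grids evaluate the gaussian up to a relative error e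
per variable. The upper bound is also stated for wider gaussians, since it
controls the error terms. *)
Lemma gauss_grid (I : finType) (rho : I -> nat) (C : I -> I -> R) (a : I -> R) (e : R) (M0 : nat) :
  (forall i, 0 < a i) -> 0 < e <= 1 ->
  exists m m' : nat, [/\ (M0 <= m)%N, (m <= m')%N,
    (forall a' : I -> R, (forall i, 0 < a' i <= a i) ->
      \sum_(th : {ffun I -> 'I_(m'.*2.+1)}) \prod_i
         ((m.*2.+1)%:R^-1 * expR (- (a' i * tri_coord (@grid_val m m') rho C th i ^+ 2)))
      <= \prod_i ((1 + e) * Num.sqrt (pi / a' i))) &
      \prod_i ((1 - e) * Num.sqrt (pi / a i)) <=
      \sum_(th : {ffun I -> 'I_(m'.*2.+1)}) \prod_i
         ((m.*2.+1)%:R^-1 * expR (- (a i * tri_coord (@grid_val m m') rho C th i ^+ 2)))].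
Proof.
move=> a0 /andP[e0 e1].
have sa i : 0 < Num.sqrt (a i) by rewrite sqrtr_gt0.
have [T0 T00 hT0] := gauss_prim_cvg (divr_gt0 e0 (ltr0Sn R 1)).
pose B : R := 1 + \sum_i (Num.sqrt (a i) + (Num.sqrt (a i))^-1).
have B1 i : Num.sqrt (a i) <= B /\ (Num.sqrt (a i))^-1 <= B.
  have h : Num.sqrt (a i) + (Num.sqrt (a i))^-1 <= B.
    rewrite /B (bigD1 i) //= addrCA lerDl addr_ge0 // sumr_ge0 //.
  have := sa i; have : 0 < (Num.sqrt (a i))^-1 by rewrite invr_gt0.
  by split; lra.
have B0 : 1 <= B.
  by rewrite /B lerDl sumr_ge0 //.
pose T : R := T0 * B.
have Tp : 0 < T by rewrite mulr_gt0 //; lra.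
pose c : R := \sum_i \sum_j `|C i j|.
pose P := (\max_i rho i)%N.
pose S := c * (T * (1 + c) ^+ P.+1).
have c0 : 0 <= c by apply: sumr_ge0 => ? _; apply: sumr_ge0.
have S0 : 0 <= S by rewrite mulr_ge0 // mulr_ge0 ?exprn_ge0 ?addr_ge0 // ltW.
pose m := (M0 + (Num.truncn (6 * B / e)).+1 + (Num.truncn (T^-1)).+1)%N.
pose M : R := (m.*2.+1)%:R.
have Mm : m%:R <= M by rewrite ler_nat -addnn leqW // leq_addr.
have M1 : 1 <= M by rewrite ler1n.
have Mp : 0 < M by lra.
have hM1 : 6 * B / e <= M.
  apply: le_trans Mm; apply: (@le_trans _ _ (Num.truncn (6 * B / e)).+1%:R).
    by rewrite ltW // truncnS_gt.
  by rewrite ler_nat /m (leq_trans (leq_addl M0 _)) // leq_addr.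
have hM2 : T^-1 <= M.
  apply: le_trans Mm; apply: (@le_trans _ _ (Num.truncn (T^-1)).+1%:R).
    by rewrite ltW // truncnS_gt.
  by rewrite ler_nat /m leq_addl.
pose m' := (m + (Num.truncn (M * (T + S))).+1)%N.
have hm' : M * (T + S) <= m'%:R.
  apply: (@le_trans _ _ (Num.truncn (M * (T + S))).+1%:R).
    by rewrite ltW // truncnS_gt.
  by rewrite ler_nat /m' leq_addl.
have h6 i : 6 * (Num.sqrt (a i) / M) <= e.
  have : 6 * B <= e * M by rewrite [e * M]mulrC -ler_pdivrMr.
  have [h _] := B1 i => h2.
  by rewrite mulrA ler_pdivrMr //; lra.
exists m, m'; split; [by rewrite /m -addnA leq_addr | by rewrite /m' leq_addr | |].
  move=> a' ha'.
  apply: (@tri_sum_le R I _ (@grid_val m m') ord0 rho C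
            (fun i y => M^-1 * expR (- (a' i * y ^+ 2)))
            (fun i => (1 + e) * Num.sqrt (pi / a' i))).
    by move=> i y; rewrite mulr_ge0 ?expR_ge0 // invr_ge0 ltW.
  move=> i s; have /andP[a'0 a'a] := ha' i.
  rewrite -mulr_sumr.
  have := @gauss_grid1_le R (a' i) M (s - m'%:R / M) e (m'.*2.+1) a'0 Mp _.
  rewrite (eq_bigr (fun k : 'I_(m'.*2.+1) => expR (- (a' i * (@grid_val m m' k + s) ^+ 2)))).
    apply; apply: le_trans (h6 i).
    rewrite mulrA ler_pM2r ?invr_gt0 //.
    have : Num.sqrt (a' i) <= Num.sqrt (a i) by rewrite ler_sqrt ?(ltW (a0 i)) //.
    by have := sqrtr_ge0 (a' i); lra.
  move=> k _; have -> // : k%:R / M + (s - m'%:R / M) = @grid_val m m' k + s.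
  by rewrite /grid_val -/M; ring.
pose g i y := M^-1 * (if `|y| <= T then expR (- (a i * y ^+ 2)) else 0 : R).
apply: (@le_trans _ _ (\sum_(th : {ffun I -> 'I_(m'.*2.+1)}) \prod_i g i (tri_coord (@grid_val m m') rho C th i))).
  have m'lt : (m' < m'.*2.+1)%N by rewrite -addnn ltnS leq_addr.
  apply: (@tri_sum_ge R _ _ (@grid_val m m') (Ordinal m'lt) rho C g _ T c P) => //.
  - by rewrite /grid_val subrr mul0r.
  - exact: ltW.
  - move=> i y; rewrite mulr_ge0 //; first by rewrite invr_ge0 ltW.
    by case: ifP => // _; exact: expR_ge0.
  - by move=> i y; rewrite /g ltNge => /negbTE ->; rewrite mulr0.
  - by move=> i; exact: leq_bigmax.
  - move=> i; rewrite /c [leRHS](bigD1 i) //= lerDl.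
    by apply: sumr_ge0 => j _; apply: sumr_ge0.
  - by move=> i; rewrite mulr_ge0 ?sqrtr_ge0 // subr_ge0.
  move=> i s hs; rewrite -/S in hs.
  have /andP[hs1 hs2] : - S <= s <= S by rewrite -ler_norml.
  rewrite -mulr_sumr.
  have TS : T + S <= m'%:R / M by rewrite ler_pdivlMr // mulrC.
  have := @gauss_grid1_ge R (a i) T M (s - m'%:R / M) e (m'.*2.+1) (a0 i) Mp e0.
  rewrite (eq_bigr (fun k : 'I_(m'.*2.+1) =>
     if `|@grid_val m m' k + s| <= T then expR (- (a i * (@grid_val m m' k + s) ^+ 2)) else 0)).
    apply; [| exact: h6 | | |].
    - have hT : T0 <= Num.sqrt (a i) * T.
        rewrite /T mulrCA ler_peMr ?(ltW T00) // -(mulfV (lt0r_neq0 (sa i))).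
        by rewrite ler_pM2l //; have [_] := B1 i.
      apply: (le_trans hT0); apply: lerB; apply: gauss_prim_le => //.
      by rewrite lerN2.
    - by rewrite -[leRHS]invrK lef_pV2 ?posrE ?invr_gt0.
    - by move: (m'%:R / M) TS => z TS; lra.
    - rewrite -[m'.*2.+1]addn1 -addnn (natrD _ (m' + m') 1) (natrD _ m' m') mulrDl mulrDl mul1r.
      move: (m'%:R / M) TS => z TS.
      have : 0 < M^-1 by rewrite invr_gt0.
      move: (M^-1) => z' z'0; lra.
  move=> k _; have -> // : k%:R / M + (s - m'%:R / M) = @grid_val m m' k + s.
  by rewrite /grid_val -/M; ring.
apply: ler_sum => th _; apply: ler_prod => i _; rewrite /g.
have M'0 : 0 < M^-1 by rewrite invr_gt0.
apply/andP; split.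
  by rewrite mulr_ge0 ?(ltW M'0) //; case: ifP => // _; exact: expR_ge0.
rewrite ler_pM2l //; case: ifP => // _; exact: expR_ge0.
Qed.
End GaussGrid.

(** * The characteristic function of one random choice *)

Section Trig.
Context {R : realType}.

(** Iterating this gives the Taylor bounds on the sine and the cosine below. *)
Lemma ge0_of_derive (f df : R -> R) : (forall x : R, is_derive x 1 f (df x)) -> f 0 = 0 ->
  (forall x, 0 <= x -> 0 <= df x) -> forall x, 0 <= x -> 0 <= f x.
Proof.
move=> fd f0 df0 x x0.
have [z zx] := @MVT_segment _ f df 0 x x0 (fun z _ => fd z)
  (derivable_within_continuous (fun z _ => @ex_derive _ _ _ _ _ _ _ (fd z))).
rewrite f0 subr0 => ->; rewrite subr0 mulr_ge0 // df0 //.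
by move: zx; rewrite in_itv => /andP[].
Qed.

Lemma sin_le (x : R) : 0 <= x -> sin x <= x.
Proof.
move=> x0; rewrite -subr_ge0; move: x x0.
apply: (@ge0_of_derive _ (fun x => 1 - cos x)).
- by rewrite sin0 subr0.
- by move=> x _; rewrite subr_ge0 cos_le1.
Qed.

Lemma cos_ge (x : R) : 1 - x ^+ 2 / 2 <= cos x.
Proof.
wlog x0 : x / 0 <= x => [h|].
  have [/h //|x0] := leP 0 x.
  by rewrite -cosN -sqrrN; apply: h; rewrite oppr_ge0 ltW.
rewrite -subr_ge0; move: x x0.
apply: (@ge0_of_derive _ (fun x => x - sin x)).
- by move=> x; apply: is_derive_eq; rewrite /GRing.scale /=; lra.
- by rewrite cos0; lra.
- by move=> x x0; rewrite subr_ge0 sin_le.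
Qed.

Lemma sin_ge (x : R) : 0 <= x -> x - x ^+ 3 / 6 <= sin x.
Proof.
move=> x0; rewrite -subr_ge0; move: x x0.
apply: (@ge0_of_derive _ (fun x => cos x - (1 - x ^+ 2 / 2))).
- by move=> x; apply: is_derive_eq; rewrite /GRing.scale /=; lra.
- by rewrite sin0; lra.
- by move=> x x0; rewrite subr_ge0 cos_ge.
Qed.

Lemma cos_le (x : R) : cos x <= 1 - x ^+ 2 / 2 + x ^+ 4 / 24.
Proof.
wlog x0 : x / 0 <= x => [h|].
  have [/h //|x0] := leP 0 x.
  have -> : x ^+ 2 = (- x) ^+ 2 by ring.
  have -> : x ^+ 4 = (- x) ^+ 4 by ring.
  by rewrite -cosN; apply: h; rewrite oppr_ge0 ltW.
rewrite -subr_ge0; move: x x0.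
apply: (@ge0_of_derive _ (fun x => sin x - (x - x ^+ 3 / 6))).
- by move=> x; apply: is_derive_eq; rewrite /GRing.scale /=; lra.
- by rewrite cos0; lra.
- by move=> x x0; rewrite subr_ge0 sin_ge.
Qed.

Lemma sin_dist (x : R) : `|sin x - x| <= `|x| ^+ 3 / 6.
Proof.
wlog x0 : x / 0 <= x => [h|].
  have [/h //|x0] := leP 0 x.
  have := h (- x); rewrite sinN normrN opprK addrC -opprB normrN; apply.
  by rewrite oppr_ge0 ltW.
rewrite (ger0_norm x0) ler_norml; have := sin_ge x0; have := sin_le x0.
have : 0 <= x ^+ 3 by rewrite exprn_ge0.
by move=> h1 h2 h3; apply/andP; split; lra.
Qed.

Lemma cos_dist (x : R) : `|cos x - (1 - x ^+ 2 / 2)| <= x ^+ 4 / 24.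
Proof.
rewrite ler_norml; have := cos_ge x; have := cos_le x.
have : 0 <= x ^+ 4 by rewrite exprn_even_ge0.
by move=> h1 h2 h3; apply/andP; split; lra.
Qed.
End Trig.

Section CharFun.
Context {R : realType}.
Implicit Types (u v p : R) (z : R[i]).
Local Open Scope complex_scope.
Import Normc.

Definition cis u : R[i] := (cos u +i* sin u)%C.

Lemma cis0 : cis 0 = 1. Proof. by rewrite /cis cos0 sin0. Qed.
Lemma cisD u v : cis (u + v) = cis u * cis v.
Proof. by apply/eqP; rewrite eq_complex /= cosD sinD eqxx /= addrC [sin u * _]mulrC [_ * sin v]mulrC. Qed.

Lemma cis_sum (I : Type) (s : seq I) (P : pred I) (f : I -> R) :
  cis (\sum_(i <- s | P i) f i) = \prod_(i <- s | P i) cis (f i).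
Proof. by apply: (big_morph cis cisD cis0). Qed.

Lemma real_complex_prod (I : Type) (s : seq I) (P : pred I) (f : I -> R) :
  (\prod_(i <- s | P i) f i)%:C = \prod_(i <- s | P i) (f i)%:C.
Proof. by apply: (big_morph (fun x : R => x%:C)) => // x y; rewrite rmorphM. Qed.

Lemma normc_real (x : R) : normc (x%:C) = `|x|.
Proof. by rewrite /normc /= expr0n /= addr0 sqrtr_sqr. Qed.

Lemma normc_le z (a b : R) : `|complex.Re z| <= a -> `|complex.Im z| <= b -> normc z <= a + b.
Proof.
case: z => x y /= xa yb; apply: (@le_trans _ _ (`|x| + `|y|)); last exact: lerD.
rewrite -[leRHS]ger0_norm ?addr_ge0 // -sqrtr_sqr ler_wsqrtr //.
rewrite -(real_normK (num_real x)) -(real_normK (num_real y)) sqrrD.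
by rewrite lerD2r lerDl mulrn_wge0 // mulr_ge0.
Qed.

Lemma normc_prod (I : Type) (s : seq I) (P : pred I) (f : I -> R[i]) :
  normc (\prod_(i <- s | P i) f i) = \prod_(i <- s | P i) normc (f i).
Proof. by apply: (big_morph (@normc R) (@normcM R) (@normc1 R)). Qed.

Lemma normc_sum (I : Type) (s : seq I) (P : pred I) (f : I -> R[i]) :
  normc (\sum_(i <- s | P i) f i) <= \sum_(i <- s | P i) normc (f i).
Proof.
elim/big_rec2: _ => [|i x y _ h]; first by rewrite normc0.
by apply: (le_trans (le_normcD _ _)); rewrite lerD2l.
Qed.

(** Replacing the factors one at a time, with a common bound c for the moduli
of both products. *)
Lemma normc_prod_diff (I : Type) (s : seq I) (a b : I -> R[i]) (c e : I -> R) :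
  (forall i, 0 <= c i) -> (forall i, 0 <= e i) ->
  (forall i, normc (a i) <= c i) -> (forall i, normc (b i) <= c i) ->
  (forall i, normc (a i - b i) <= e i * c i) ->
  normc (\prod_(i <- s) a i - \prod_(i <- s) b i) <= (\sum_(i <- s) e i) * \prod_(i <- s) c i.
Proof.
move=> c0 e0 ac bc abc; elim: s => [|i s IH].
  by rewrite !big_nil subrr normc0 mul0r.
rewrite !big_cons.
have -> : a i * \prod_(j <- s) a j - b i * \prod_(j <- s) b j =
  (a i - b i) * \prod_(j <- s) a j + b i * (\prod_(j <- s) a j - \prod_(j <- s) b j) by ring.
apply: (le_trans (le_normcD _ _)); rewrite !normcM normc_prod.
have n0 z : 0 <= normc z by case: z => x y; exact: sqrtr_ge0.
have h1 : \prod_(j <- s) normc (a j) <= \prod_(j <- s) c j.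
  by apply: ler_prod => j _; rewrite n0 ac.
have h0 : 0 <= \prod_(j <- s) normc (a j) by apply: prodr_ge0 => j _; exact: n0.
have h2 := ler_pM (n0 _) h0 (abc i) h1.
have h3 := ler_pM (n0 _) (n0 _) (bc i) IH.
apply: (le_trans (lerD h2 h3)).
by rewrite le_eqVlt; apply/orP; left; apply/eqP; ring.
Qed.

(** The characteristic function of a Bernoulli variable of mean p, centred. *)
Definition psi p u : R[i] := (1 - p)%:C * cis (- (p * u)) + p%:C * cis ((1 - p) * u).

Lemma normc_psi p u : normc (psi p u) = Num.sqrt (1 - 2 * (p * (1 - p)) * (1 - cos u)).
Proof.
rewrite /psi /normc /=; congr Num.sqrt; rewrite !mul0r !addr0 !subr0.
have -> : cos u = cos ((1 - p) * u - - (p * u)) by congr cos; ring.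
rewrite cosB cosN sinN.
have h1 := cos2Dsin2 (p * u); have h2 := cos2Dsin2 ((1 - p) * u).
set c1 := cos (p * u) in h1 *; set s1 := sin (p * u) in h1 *.
set c2 := cos ((1 - p) * u) in h2 *; set s2 := sin ((1 - p) * u) in h2 *.
rewrite (_ : 2 * _ * _ = 2 * (p * (1 - p)) - 2 * (p * (1 - p)) * (c2 * c1 + s2 * - s1)); last by ring.
apply/eqP; rewrite -subr_eq0; apply/eqP.
transitivity ((1 - p) ^+ 2 * (c1 ^+ 2 + s1 ^+ 2 - 1) + p ^+ 2 * (c2 ^+ 2 + s2 ^+ 2 - 1)); first by ring.
by rewrite h1 h2; ring.
Qed.

(** From the exact modulus, by 1 - 2 x <= exp (- 2 x). *)
Lemma normc_psi_le p u : 0 <= p <= 1 ->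
  normc (psi p u) <= expR (- (p * (1 - p) * (1 - cos u))).
Proof.
move=> /andP[p0 p1]; rewrite normc_psi.
set x := p * (1 - p) * (1 - cos u).
have -> : 1 - 2 * (p * (1 - p)) * (1 - cos u) = 1 - 2 * x by rewrite /x; ring.
rewrite -[leRHS]ger0_norm ?expR_ge0 // -sqrtr_sqr ler_wsqrtr //.
rewrite -expRM_natl; apply: le_trans (expR_ge1Dx _); lra.
Qed.

Lemma expRN_dist (z : R) : 0 <= z -> `|expR (- z) - (1 - z)| <= z ^+ 2.
Proof.
move=> z0; rewrite ger0_norm; last by have := expR_ge1Dx (- z); lra.
rewrite expRN; have h : (expR z)^-1 <= (1 + z)^-1.
  by rewrite lef_pV2 ?posrE ?expR_gt0 ?expR_ge1Dx //; lra.
suff : (1 + z)^-1 <= 1 - z + z ^+ 2 by lra.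
rewrite -[leLHS]mul1r ler_pdivrMr; last by lra.
have : 0 <= z ^+ 3 by rewrite exprn_ge0.
rewrite (_ : (1 - z + z ^+ 2) * (1 + z) = 1 + z ^+ 3); [lra | ring].
Qed.

(** Taylor expansion to third order; the mean vanishes and the variance is
p (1 - p), so the terms of order at most two agree with those of the
gaussian. *)
Lemma psi_gauss p u : 0 <= p <= 1 -> `|u| <= 1 ->
  normc (psi p u - (expR (- (p * (1 - p) / 2 * u ^+ 2)))%:C) <= p * (1 - p) * `|u| ^+ 3.
Proof.
move=> /andP[p0 p1] u1.
set v := p * (1 - p).
have v0 : 0 <= v by rewrite mulr_ge0 // subr_ge0.
have v1 : v <= 1 by rewrite /v; nra.
have ua := normr_ge0 u; have u2 : `|u| ^+ 2 = u ^+ 2 by rewrite real_normK ?num_real.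
have u3 : 0 <= `|u| ^+ 3 by rewrite exprn_ge0.
have u4 : u ^+ 4 <= `|u| ^+ 3.
  have -> : u ^+ 4 = `|u| * `|u| ^+ 3 by rewrite -exprS [RHS](exprM _ 2 2) u2 -exprM.
  by rewrite ler_piMl.
have q0 : 0 <= 1 - p by lra.
have hc1 := cos_dist (p * u); have hc2 := cos_dist ((1 - p) * u).
have hs1 := sin_dist (p * u); have hs2 := sin_dist ((1 - p) * u).
have he := @expRN_dist (v / 2 * u ^+ 2) (mulr_ge0 (divr_ge0 v0 (ler0n _ _)) (sqr_ge0 u)).
have -> : v * `|u| ^+ 3 = (v * `|u| ^+ 3 / 2) + (v * `|u| ^+ 3 / 2) by lra.
apply: normc_le.
- have -> : complex.Re (psi p u - (expR (- (v / 2 * u ^+ 2)))%:C) =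
    ((1 - p) * (cos (p * u) - (1 - (p * u) ^+ 2 / 2))) + (p * (cos ((1 - p) * u) - (1 - ((1 - p) * u) ^+ 2 / 2)))
      - (expR (- (v / 2 * u ^+ 2)) - (1 - v / 2 * u ^+ 2)).
    by rewrite /= !mul0r !subr0 cosN /v; ring.
  apply: (le_trans (ler_normB _ _)); apply: (le_trans (lerD (ler_normD _ _) he)).
  rewrite !normrM (ger0_norm p0) (ger0_norm q0).
  have := ler_wpM2l q0 hc1; have := ler_wpM2l p0 hc2.
  move: (`|cos _ - _|) => X; move: (`|cos _ - _|) => Y hX hY.
  have e1 : (1 - p) * ((p * u) ^+ 4 / 24) <= v * (u ^+ 4 / 24).
    rewrite [leLHS](_ : _ = v * (u ^+ 4 / 24) * p ^+ 3); last by rewrite /v; ring.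
    by rewrite ler_piMr ?exprn_ile1 // mulr_ge0 // divr_ge0 // exprn_even_ge0.
  have e2 : p * (((1 - p) * u) ^+ 4 / 24) <= v * (u ^+ 4 / 24).
    rewrite [leLHS](_ : _ = v * (u ^+ 4 / 24) * (1 - p) ^+ 3); last by rewrite /v; ring.
    by rewrite ler_piMr ?exprn_ile1 //; [rewrite mulr_ge0 // divr_ge0 // exprn_even_ge0 | lra].
  have e3 : (v / 2 * u ^+ 2) ^+ 2 <= v * (u ^+ 4 / 4).
    rewrite [leLHS](_ : _ = v * (u ^+ 4 / 4) * v); last by field.
    by rewrite ler_piMr // mulr_ge0 // divr_ge0 // exprn_even_ge0.
  have h4 := ler_wpM2l v0 u4; have := mulr_ge0 v0 u3; lra.
- have -> : complex.Im (psi p u - (expR (- (v / 2 * u ^+ 2)))%:C) =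
    p * (sin ((1 - p) * u) - (1 - p) * u) - (1 - p) * (sin (p * u) - p * u).
    by rewrite /= !mul0r !addr0 sinN; ring.
  apply: (le_trans (ler_normB _ _)).
  rewrite !(normrM p) !(normrM (1 - p)) (ger0_norm p0) (ger0_norm q0) in hs1 hs2 *.
  have := ler_wpM2l q0 hs1; have := ler_wpM2l p0 hs2.
  move: (`|sin _ - _|) => X; move: (`|sin _ - _|) => Y hX hY.
  have e1 : (1 - p) * ((p * `|u|) ^+ 3 / 6) <= v * (`|u| ^+ 3 / 6).
    rewrite [leLHS](_ : _ = v * (`|u| ^+ 3 / 6) * p ^+ 2); last by rewrite /v; ring.
    by rewrite ler_piMr ?exprn_ile1 // mulr_ge0 // divr_ge0.
  have e2 : p * (((1 - p) * `|u|) ^+ 3 / 6) <= v * (`|u| ^+ 3 / 6).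
    rewrite [leLHS](_ : _ = v * (`|u| ^+ 3 / 6) * (1 - p) ^+ 2); last by rewrite /v; ring.
    by rewrite ler_piMr ?exprn_ile1 //; [rewrite mulr_ge0 // divr_ge0 | lra].
  have := mulr_ge0 v0 u3; lra.
Qed.

(** The factors are replaced by gaussians one at a time. The common majorant of
the factors is a gaussian whose exponent is smaller by the fraction tau only: a
constant fraction would cost a factor exponential in the dimension. *)
Lemma psi_prod_gauss (B : finType) p (u : B -> R) (tau : R) : 0 <= p <= 1 ->
  0 <= tau -> (forall x, `|u x| <= 1) -> (forall x, u x ^+ 2 <= 12 * tau) ->
  normc (\prod_x psi p (u x) - (expR (- (p * (1 - p) / 2 * \sum_x u x ^+ 2)))%:C) <=
  (\sum_x 2 * (p * (1 - p) * `|u x| ^+ 3)) *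
    expR (- ((1 - tau) * (p * (1 - p) / 2 * \sum_x u x ^+ 2))).
Proof.
move=> p01 tau0 u1 ut; have /andP[p0 p1] := p01.
set v := p * (1 - p).
have v0 : 0 <= v by rewrite mulr_ge0 // subr_ge0.
have v1 : v <= 1 by rewrite /v; nra.
have w0 x : 0 <= v / 2 * u x ^+ 2 by rewrite mulr_ge0 ?sqr_ge0 // divr_ge0.
have u2 x : u x ^+ 2 <= 1.
  by rewrite -(real_normK (num_real (u x))) exprn_ile1.
rewrite !mulr_sumr -!sumrN !expR_sum.
rewrite real_complex_prod.
apply: normc_prod_diff => x.
- exact: expR_ge0.
- by apply: mulr_ge0 => //; apply: mulr_ge0; [exact: v0 | exact: exprn_ge0].
- apply: (le_trans (normc_psi_le _ p01)); rewrite ler_expR lerN2 -/v.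
  have := cos_le (u x); have := ut x; have := sqr_ge0 (u x).
  have -> : u x ^+ 4 = u x ^+ 2 * u x ^+ 2 by ring.
  move: (u x ^+ 2) (cos (u x)) => U c U0 Ut hc.
  rewrite [leLHS](_ : _ = v * ((1 - tau) * (U / 2))); last by ring.
  apply: ler_wpM2l => //; nra.
- rewrite normc_real ger0_norm ?expR_ge0 // ler_expR lerN2.
  by have := w0 x; nra.
apply: (le_trans (psi_gauss p01 (u1 x))); rewrite -/v.
have h2 : 2^-1 <= expR (- ((1 - tau) * (v / 2 * u x ^+ 2))).
  apply: le_trans (expR_ge1Dx _).
  have := w0 x; have := u2 x; nra.
have : 0 <= v * `|u x| ^+ 3 by rewrite mulr_ge0 ?exprn_ge0.
nra.
Qed.
End CharFun.

(** * Fourier inversion on a grid *)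

Section Fourier.
Context {R : realType}.
Local Open Scope complex_scope.
Import Normc.

Lemma cisX (x : R) (n : nat) : cis (n%:R * x) = cis x ^+ n.
Proof.
elim: n => [|n IH]; first by rewrite mul0r cis0.
by rewrite -natr1 mulrDl mul1r cisD IH exprSr.
Qed.

Lemma cis2pi : cis (2 * pi : R) = 1.
Proof. by rewrite /cis mulr_natl cos2pi sin2pi. Qed.

Lemma cis_unit (x : R) : cis x * cis (- x) = 1.
Proof. by rewrite -cisD subrr cis0. Qed.

Lemma cis2piB (a b : nat) : cis (2 * pi * (a%:R - b%:R) : R) = 1.
Proof.
have h (n : nat) : cis (2 * pi * n%:R : R) = 1 by rewrite mulrC cisX cis2pi expr1n.
have := cis_unit (2 * pi * b%:R); rewrite h mul1r => hb.
by rewrite mulrBr cisD h hb mulr1.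
Qed.

(** The 2 m + 1 central steps of the grid, one full period of the
characters. *)
Definition in_window (m m' k : nat) : bool := (m' - m <= k <= m' + m)%N.

Lemma sum_window (V : nmodType) (m m' : nat) (F : nat -> V) : (m <= m')%N ->
  \sum_(k < m'.*2.+1 | in_window m m' k) F k = \sum_(j < m.*2.+1) F (j + (m' - m))%N.
Proof.
move=> mm'.
rewrite -(big_mkord xpredT (fun j => F (j + (m' - m))%N)).
rewrite -[X in \sum_(0 <= i < X) _](addnK (m' - m)%N) -[X in \sum_(X <= i < _) _](add0n 0%N).
have -> : (m.*2.+1 + (m' - m) = m' + m.+1)%N by lia.
rewrite -(big_addn 0 (m' + m.+1) (m' - m) xpredT F) add0n.
rewrite (big_nat_widenl _ 0) // (big_nat_widen _ _ (m'.*2.+1)) ?big_mkord; last by lia.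
by apply: eq_bigl => k; rewrite /in_window addnS ltnS.
Qed.

Lemma cos_lt1 (u : R) : u != 0 -> u ^+ 2 <= 4 -> cos u < 1.
Proof.
move=> u0 u4; apply: (le_lt_trans (cos_le u)).
have : 0 < u ^+ 2 by rewrite exprn_even_gt0.
have -> : u ^+ 4 = u ^+ 2 * u ^+ 2 by ring.
nra.
Qed.

(** Orthogonality of characters: a geometric sum whose ratio is not 1, because
a nonzero difference of integers smaller than a quarter of the period turns by
a nonzero angle of modulus at most 2. *)
Lemma grid_orth (m m' a b Q : nat) : (m <= m')%N -> (a <= Q)%N -> (b <= Q)%N ->
  (4 * Q <= m.*2.+1)%N ->
  \sum_(k < m'.*2.+1 | in_window m m' k)
     cis (2 * pi * (@grid_val R m m' k * (a%:R - b%:R))) =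
  (if a == b then (m.*2.+1)%:R else 0).
Proof.
move=> mm' aQ bQ Qm; set M := m.*2.+1.
have M0 : 0 < (M%:R : R) by rewrite ltr0n.
pose F (k : nat) : R[i] := cis (2 * pi * ((k%:R - m'%:R) / M%:R * (a%:R - b%:R) : R)).
rewrite (sum_window F mm').
case: eqP => [ab|/eqP ab].
  under eq_bigr do rewrite /F ab subrr !mulr0 cis0.
  by rewrite sumr_const card_ord.
pose w : R := 2 * pi * (a%:R - b%:R) / M%:R.
have Fw j : F (j + (m' - m))%N = cis (- (m%:R * w)) * cis w ^+ j.
  rewrite -cisX -cisD /F; congr cis.
  by rewrite natrD natrB // /w; field; rewrite lt0r_neq0.
under eq_bigr do rewrite Fw.
rewrite -mulr_sumr.
have w1 : cis w - 1 != 0.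
  apply/negP; rewrite subr_eq0 eq_complex /= => /andP[/eqP cw _].
  have : cos w < 1; last by rewrite cw ltxx.
  have ab0 : (a%:R - b%:R : R) != 0 by rewrite subr_eq0 eqr_nat.
  apply: cos_lt1.
    have pi0 : (pi : R) != 0 by rewrite lt0r_neq0 ?pi_gt0.
    have M'0 : (M%:R : R) != 0 by rewrite lt0r_neq0.
    by rewrite /w; do ?[apply: mulf_neq0 | apply: invr_neq0].
  have abQ : `|a%:R - b%:R : R| <= Q%:R.
    have : (a%:R : R) <= Q%:R by rewrite ler_nat.
    have : (b%:R : R) <= Q%:R by rewrite ler_nat.
    have := ler0n R a; have := ler0n R b.
    by move=> h1 h2 h3 h4; rewrite ler_norml; apply/andP; split; lra.
  have hM : 4 * Q%:R <= (M%:R : R) by rewrite -natrM ler_nat.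
  have hw : `|w| <= 2.
    rewrite /w !normrM normfV (gtr0_norm M0) (ger0_norm (pi_ge0 R)) ger0_norm //.
    rewrite ler_pdivrMr //.
    have := pihalf_lt2 R; have := pi_gt0 R; have := normr_ge0 (a%:R - b%:R : R).
    nra.
  rewrite -(real_normK (num_real w)).
  by have := normr_ge0 w; nra.
have : (cis w - 1) * \sum_(j < M) cis w ^+ j = 0.
  rewrite -subrX1 -cisX /w.
  have -> : M%:R * (2 * pi * (a%:R - b%:R) / M%:R) = 2 * pi * (a%:R - b%:R) :> R.
    by field; rewrite lt0r_neq0.
  by rewrite cis2piB subrr.
by move/eqP; rewrite mulf_eq0 (negbTE w1) /= => /eqP ->; rewrite mulr0.
Qed.

Section Inversion.
Variables (B W : finType) (f : W -> B -> bool) (p : R) (E : W -> nat).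
Hypothesis hE : forall w, p * \sum_x (f w x)%:R = (E w)%:R.
Hypothesis p01 : 0 <= p <= 1.

Definition lin (th : W -> R) (x : B) : R := \sum_w th w * (f w x)%:R.

Definition hit (T : {set B}) : bool := [forall w, (\sum_(x in T) f w x)%N == E w].

Definition prob_hit : R :=
  \sum_(T : {set B}) p ^+ #|T| * (1 - p) ^+ (#|B| - #|T|) * (hit T)%:R.

(** The characteristic function, at th, of the centred vector of the sums of
the f w over a random set. *)
Definition chf (th : W -> R) : R[i] := \prod_x psi p (2 * pi * lin th x).

(** Expanding the product over the points chooses for each of them whether it
belongs to T. *)
Lemma chfE th : chf th = \sum_(T : {set B})
  (p ^+ #|T| * (1 - p) ^+ (#|B| - #|T|))%:C *
    \prod_w cis (2 * pi * (th w * ((\sum_(x in T) f w x)%N%:R - (E w)%:R))).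
Proof.
rewrite /chf /psi; under eq_bigr do rewrite addrC.
rewrite bigA_distr; apply: eq_bigr => T _.
rewrite (bigID (mem T)) /=.
under eq_bigr => x xT do rewrite xT.
under [X in _ * X]eq_bigr => x xT do rewrite (negbTE xT).
rewrite !big_split /= !prodr_const.
have -> : #|[pred x | x \notin T]| = (#|B| - #|T|)%N by rewrite -(cardC (mem T)) addKn.
rewrite -!cis_sum rmorphM /= !rmorphXn /=.
rewrite mulrACA -cisD; congr (_ * cis _).
have -> : \sum_w 2 * pi * (th w * ((\sum_(x in T) f w x)%N%:R - (E w)%:R)) =
   \sum_w 2 * pi * (th w * (\sum_(x in T) (f w x)%:R - p * \sum_x (f w x)%:R)).
  by apply: eq_bigr => w _; rewrite hE natr_sum.
rewrite sumrN -mulr_sumr -mulr_sumr.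
rewrite -!mulr_sumr.
have lE (P : pred B) : \sum_(x | P x) lin th x = \sum_w th w * \sum_(x | P x) (f w x)%:R.
  by rewrite /lin exchange_big; apply: eq_bigr => w _; rewrite mulr_sumr.
have -> : \sum_(x | x \notin T) lin th x = \sum_x lin th x - \sum_(x in T) lin th x.
  by rewrite [in RHS](bigID (mem T)) /= addrC addrK.
have -> : \sum_w th w * (\sum_(x in T) (f w x)%:R - p * \sum_x (f w x)%:R) =
  \sum_(x in T) lin th x - p * \sum_x lin th x.
  rewrite (lE (mem T)) (lE xpredT) mulr_sumr -sumrB.
  by apply: eq_bigr => w _; rewrite mulrBr mulrCA.
by ring.
Qed.

(** The grid points of the cube of side 1 centred at 0, a fundamental domain of
the torus. *)
Definition in_cube (m m' : nat) (th : {ffun W -> 'I_(m'.*2.+1)}) : bool :=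
  [forall w, in_window m m' (th w)].

Lemma hit_bound (T : {set B}) w : (\sum_(x in T) f w x <= #|B|)%N.
Proof.
apply: leq_trans (max_card (mem T)); rewrite -sum1_card.
by apply: leq_sum => x _; case: (f w x).
Qed.

Lemma E_bound w : (E w <= #|B|)%N.
Proof.
have /andP[p0 p1] := p01.
rewrite -(ler_nat R) -hE.
have h : \sum_x (f w x)%:R <= (#|B|%:R : R).
  by rewrite -sum1_card natr_sum; apply: ler_sum => x _; rewrite ler_nat; case: (f w x).
apply: le_trans h; rewrite ler_piMl // sumr_ge0 // => x _; exact: ler0n.
Qed.

(** Exact Fourier inversion: the sums are integers of modulus at most #|B|,
which a period of more than 4 #|B| steps separates. *)
Lemma prob_hitE (m m' : nat) : (m <= m')%N -> (4 * #|B| <= m.*2.+1)%N ->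
  prob_hit%:C = \sum_(th : {ffun W -> 'I_(m'.*2.+1)} | in_cube m th)
     ((m.*2.+1)%:R^-1 ^+ #|W|)%:C * chf (fun w => @grid_val R m m' (th w)).
Proof.
move=> mm' Bm; set M := m.*2.+1.
have M0 : (M%:R : R) != 0 by rewrite pnatr_eq0.
under eq_bigr do rewrite chfE mulr_sumr.
rewrite exchange_big /= /prob_hit.
rewrite (big_morph (fun x : R => x%:C) (id1 := 0) (op1 := +%R)) //; last by move=> x y; rewrite rmorphD.
apply: eq_bigr => T _.
under eq_bigr do rewrite mulrCA.
rewrite -mulr_sumr rmorphM /=; congr (_ * _).
rewrite -mulr_sumr.
have -> : \sum_(th : {ffun W -> 'I_(m'.*2.+1)} | in_cube m th)
   \prod_w cis (2 * pi * (@grid_val R m m' (th w) * ((\sum_(x in T) f w x)%N%:R - (E w)%:R))) =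
   \prod_w \sum_(k < m'.*2.+1 | in_window m m' k)
     cis (2 * pi * (@grid_val R m m' k * ((\sum_(x in T) f w x)%N%:R - (E w)%:R))).
  rewrite bigA_distr_big; apply: eq_bigl => th.
  by apply/forallP/ffun_onP => h w; exact: h.
under eq_bigr => w _ do rewrite (grid_orth mm' (hit_bound T w) (E_bound w) Bm).
case: (boolP (hit T)) => [/forallP hT|].
  under eq_bigr => w _ do rewrite hT.
  rewrite prodr_const -/M rmorphXn /= -exprMn.
  have -> : (M%:R^-1)%:C * M%:R = 1 :> R[i].
    by rewrite -(rmorph_nat (real_complex R)) -rmorphM /= mulVf.
  by rewrite expr1n.
rewrite negb_forall => /existsP [w /negbTE hw].
by rewrite (bigD1 w) //= hw mul0r mulr0.
Qed.

End Inversion.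
End Fourier.

(** * The local limit theorem *)

Section Aux.
Context {R : realType}.
Import Normc.
Local Open Scope complex_scope.

(** The Cauchy-Schwarz inequality with a constant function, from the
nonnegativity of the variance. *)
Lemma sum_sqr_le (B : finType) (F : B -> R) :
  (\sum_x F x) ^+ 2 <= #|B|%:R * \sum_x F x ^+ 2.
Proof.
set S := \sum_x F x; set q : R := #|B|%:R.
have [B0|B0] := posnP #|B|.
  rewrite /S big1 ?expr0n /= ?mulr_ge0 ?sumr_ge0 // => x _; first by rewrite sqr_ge0.
  by have := fintype0 x B0.
have q0 : 0 < q by rewrite ltr0n.
have : 0 <= \sum_x (q * F x - S) ^+ 2 by apply: sumr_ge0 => x _; exact: sqr_ge0.
have -> : \sum_x (q * F x - S) ^+ 2 = q * (q * \sum_x F x ^+ 2 - S ^+ 2).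
  have e (s : R) : \sum_x (q * F x - s) ^+ 2 =
     q ^+ 2 * \sum_x F x ^+ 2 - (2 * q * s) * \sum_x F x + q * s ^+ 2.
    have -> : q * s ^+ 2 = \sum_(x : B) s ^+ 2 by rewrite sumr_const -mulr_natl.
    by rewrite !mulr_sumr -sumrB -big_split /=; apply: eq_bigr => x _; ring.
  by rewrite e -/S; ring.
by rewrite pmulr_rge0 // subr_ge0.
Qed.

Lemma bernoulli (x : R) (n : nat) : 0 <= x <= 1 -> 1 - n%:R * x <= (1 - x) ^+ n.
Proof.
move=> /andP[x0 x1]; elim: n => [|n IH]; first by rewrite mul0r subr0 expr0.
rewrite exprS -natr1.
have h : 0 <= n%:R * x by rewrite mulr_ge0.
have := ler_wpM2l (_ : 0 <= 1 - x) IH; rewrite subr_ge0 => /(_ x1); nra.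
Qed.

Lemma expr1D_le (x : R) (n : nat) : 0 <= x -> n%:R * x <= 1 / 2 -> (1 + x) ^+ n <= 1 + 2 * (n%:R * x).
Proof.
move=> x0 nx.
elim: n nx => [|n IH]; first by rewrite expr0 mul0r mulr0 addr0.
rewrite exprS -natr1 => nx.
have h : 0 <= n%:R * x by rewrite mulr_ge0.
have {}IH := IH (_ : n%:R * x <= 1 / 2).
have := ler_wpM2l (_ : 0 <= 1 + x) (IH _); rewrite addr_ge0 // => /(_ isT).
nra.
Qed.

(** On half a period |sin (pi x)| is comparable to the distance to the nearest
integer. *)
Lemma sin_half (x : R) : `|x| <= 1 / 2 -> `|x| <= 2 * `|sin (pi * x)|.
Proof.
wlog x0 : x / 0 <= x => [h|].
  have [/h //|x0 hx] := leP 0 x.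
  by have := h (- x); rewrite mulrN sinN !normrN; apply => //; rewrite oppr_ge0 ltW.
rewrite (ger0_norm x0) => hx.
have pi2 := pi_ge2 R; have pi4 := pihalf_lt2 R.
have y0 : 0 <= pi * x by rewrite mulr_ge0 ?pi_ge0.
have := sin_ge y0; set y := pi * x in y0 *.
have y2 : y <= 2 by rewrite /y; nra.
have yx : 2 * x <= y by rewrite /y; nra.
have -> : y ^+ 3 = y * (y * y) by ring.
move=> h; have := ler_norm (sin y).
nra.
Qed.

Lemma expR_ge_sqr (x : R) : 0 <= x -> x ^+ 2 / 2 <= expR x.
Proof. by move=> x0; have := @expR_ge1Dxn R x 1 x0; rewrite (_ : (1.+1)`! = 2)%N //; lra. Qed.

Lemma expRN_le_inv (x : R) : 0 < x -> expR (- x) <= x^-1.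
Proof.
move=> x0; rewrite expRN lef_pV2 ?posrE ?expR_gt0 //.
by have := expR_ge1Dx x; lra.
Qed.

End Aux.

Section LLT.
Context {R : realType}.
Import Normc.
Local Open Scope complex_scope.
Variables (B W : finType) (f : W -> B -> bool) (p : R) (E : W -> nat).
Variables (rho : W -> nat) (C : W -> W -> R) (d : W -> R) (A : R).

Local Notation q := (#|B|%:R : R).
Local Notation r := (#|W|%:R : R).
Local Notation v := (p * (1 - p)).
Local Notation s2 := (p * (1 - p) * #|B|%:R).
Local Notation L := (lin f).
(* lam is the fraction of the gaussian exponent kept in the error terms; 1 / D is,
   up to a constant, a lower bound for the mean square distance to the integers
   of the values at far frequencies; Y / sqrt s2 is the relative error. *)
Local Notation lam := (1 - (2 * r)^-1).
Local Notation D := (128 * A ^+ 2 * r ^+ 4).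
Local Notation Y := (512 * A ^+ 2 * r ^+ 5).

Hypothesis hE : forall w, p * \sum_x (f w x)%:R = (E w)%:R.
Hypothesis p01 : 0 < p < 1.
Hypothesis A1 : 1 <= A.
Hypothesis W0 : (0 < #|W|)%N.
Hypothesis B0 : (0 < #|B|)%N.
Hypothesis hL : forall th : W -> R, \sum_x L th x ^+ 2 =
  \sum_u d u * (th u + \sum_(w | (rho w < rho u)%N) C u w * th w) ^+ 2.
Hypothesis hd : forall u, 0 < d u <= q.
(* The next three hypotheses say that a coefficient or a value is at most A times
   the mean over B; for the sine this is a statement modulo 1. *)
Hypothesis h_sin : forall (th : W -> R) w,
  q * `|sin (pi * th w)| <= A * \sum_x `|sin (pi * L th x)|.
Hypothesis h_abs : forall (th : W -> R) w, q * `|th w| <= A * \sum_x `|L th x|.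
Hypothesis h_max : forall (th : W -> R) x, q * `|L th x| <= A * \sum_x `|L th x|.
Hypothesis hs2 : Y ^+ 2 <= s2.

Definition gauss_coef (u : W) : R := 2 * pi ^+ 2 * v * d u.

(** Half the variance of the linear form th, written in the triangular
coordinates; the characteristic function is close to exp (- gauss_form th). *)
Definition gauss_form (th : W -> R) : R :=
  \sum_u gauss_coef u * (th u + \sum_(w | (rho w < rho u)%N) C u w * th w) ^+ 2.

Let p01' : 0 <= p <= 1. Proof. by case/andP: p01 => /ltW -> /ltW ->. Qed.
Let q0 : 0 < q. Proof. by rewrite ltr0n. Qed.
Let v0 : 0 < v. Proof. by case/andP: p01 => h1 h2; rewrite mulr_gt0 // subr_gt0. Qed.
Let r1 : 1 <= r. Proof. by rewrite ler1n. Qed.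
Let s20 : 0 < s2. Proof. by rewrite mulr_gt0. Qed.

Lemma gauss_formE th : gauss_form th = v / 2 * \sum_x (2 * pi * L th x) ^+ 2.
Proof.
have -> : \sum_x (2 * pi * L th x) ^+ 2 = (2 * pi) ^+ 2 * \sum_x L th x ^+ 2.
  by rewrite mulr_sumr; apply: eq_bigr => x _; rewrite exprMn.
rewrite hL /gauss_form !mulr_sumr; apply: eq_bigr => u _; rewrite /gauss_coef.
by field.
Qed.

(** A bound by the mean gives a bound by the quadratic mean. *)
Lemma sqr_avg (F : B -> R) (t : R) : 0 <= t -> q * t <= A * \sum_x `|F x| ->
  q * t ^+ 2 <= A ^+ 2 * \sum_x F x ^+ 2.
Proof.
move=> t0 h.
have h1 : (q * t) ^+ 2 <= (A * \sum_x `|F x|) ^+ 2.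
  rewrite lerXn2r // nnegrE ?mulr_ge0 ?sumr_ge0 ?(ltW q0) //.
  by apply: le_trans A1.
have h2 := sum_sqr_le (fun x => `|F x|).
have e : \sum_x `|F x| ^+ 2 = \sum_x F x ^+ 2.
  by apply: eq_bigr => x _; rewrite real_normK ?num_real.
rewrite e in h2.
rewrite -(ler_pM2l q0).
apply: le_trans (_ : A ^+ 2 * (q * \sum_x F x ^+ 2) <= _); last by rewrite mulrCA.
apply: le_trans (ler_wpM2l (sqr_ge0 A) h2).
by rewrite -exprMn (_ : q * (q * t ^+ 2) = (q * t) ^+ 2) //; ring.
Qed.

(** No value of the linear form is large compared with its standard deviation;
this makes the third order terms small. *)
Lemma lin_sqr_le th x : s2 * (2 * pi * L th x) ^+ 2 <= A ^+ 2 * (2 * gauss_form th).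
Proof.
have h := sqr_avg (normr_ge0 _) (h_max th x).
rewrite real_normK ?num_real // in h.
have := ler_wpM2l (ltW v0) (ler_wpM2l (sqr_ge0 (2 * pi)) h).
rewrite gauss_formE.
have -> : \sum_x (2 * pi * L th x) ^+ 2 = (2 * pi) ^+ 2 * \sum_x L th x ^+ 2.
  by rewrite mulr_sumr; apply: eq_bigr => y _; rewrite exprMn.
congr (_ <= _); by [ring | field].
Qed.

Let A2 : 1 <= A ^+ 2. Proof. exact: exprn_ege1. Qed.
Let rn n : 1 <= r ^+ n. Proof. exact: exprn_ege1. Qed.
Let D0 : 0 < D. Proof. by have := rn 4; have := A2; nra. Qed.
Let Y1 : 1 <= Y. Proof. by have := rn 5; have := A2; nra. Qed.
Let Ysig : Y <= Num.sqrt s2.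
Proof. by rewrite -[leLHS]ger0_norm ?(le_trans _ Y1) // -sqrtr_sqr ler_wsqrtr. Qed.
Let sig1 : 1 <= Num.sqrt s2. Proof. exact: le_trans Ysig. Qed.
Let s21 : 1 <= s2. Proof. by apply: le_trans hs2; exact: exprn_ege1. Qed.

Lemma gauss_form_ge0 th : 0 <= gauss_form th.
Proof.
rewrite gauss_formE; apply: mulr_ge0; first by rewrite divr_ge0 // ltW.
by apply: sumr_ge0 => x _; exact: sqr_ge0.
Qed.

(** With z = 2 gauss_form th the third order terms are at most a multiple of
A z ^ (3/2) / sigma. Lowering the exponent of the gaussian from 1 - 1 / (4 r)
to lam absorbs the power of z at the cost of a factor r ^ 2. *)
Lemma near_bound th : (forall w, `|th w| <= (8 * r ^+ 2)^-1) ->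
  normc (chf f p th - (expR (- gauss_form th))%:C) <= (Y / Num.sqrt s2) * expR (- (lam * gauss_form th)).
Proof.
move=> near; have A1x := A1; have r1x := r1; have A2x := A2.
have Lb x : `|2 * pi * L th x| <= r^-1.
  have h : `|L th x| <= r * (8 * r ^+ 2)^-1.
    apply: (le_trans (ler_norm_sum _ _ _)).
    rewrite mulr_natl -sumr_const; apply: ler_sum => w _.
    by rewrite normrM -[leRHS]mulr1 ler_pM // ger0_norm ?ler0n // lern1; case: (f w x).
  rewrite normrM ger0_norm ?mulr_ge0 ?pi_ge0 //.
  apply: (le_trans (ler_wpM2l _ h)); first by rewrite mulr_ge0 ?pi_ge0.
  have -> : 2 * pi * (r * (8 * r ^+ 2)^-1) = (2 * pi / 8) * r^-1.
    by field; rewrite lt0r_neq0 // (lt_le_trans _ r1).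
  rewrite ler_piMl ?invr_ge0 //.
  by have := pihalf_lt2 R; lra.
have r0 : 0 < r by apply: lt_le_trans r1.
have rV : 0 < r^-1 <= 1 by rewrite invr_gt0 r0 invf_le1.
have /andP[rV0 rV1] := rV.
have tau0 : 0 <= (4 * r)^-1 by rewrite invr_ge0; lra.
have h12 x : (2 * pi * L th x) ^+ 2 <= 12 * (4 * r)^-1.
  have -> : 12 * (4 * r)^-1 = 3 * r^-1 by field; rewrite lt0r_neq0.
  rewrite -(real_normK (num_real _)).
  have := Lb x; have := normr_ge0 (2 * pi * L th x); nra.
have := psi_prod_gauss p01' tau0 (fun x => le_trans (Lb x) rV1) h12.
rewrite -gauss_formE => /le_trans; apply.
set t := Num.sqrt (2 * gauss_form th).
have t0 : 0 <= t by exact: sqrtr_ge0.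
have t2 : t ^+ 2 = 2 * gauss_form th by rewrite sqr_sqrtr // mulr_ge0 // gauss_form_ge0.
set sg := Num.sqrt s2.
have sg0 : 0 < sg by rewrite sqrtr_gt0.
have sg2 : sg ^+ 2 = s2 by rewrite sqr_sqrtr // ltW.
have ub x : `|2 * pi * L th x| <= A * t / sg.
  rewrite ler_pdivlMr // -ler_sqr ?nnegrE ?mulr_ge0 // ?(ltW sg0) //; last by lra.
  rewrite !exprMn real_normK ?num_real // sg2 t2 mulrC.
  exact: lin_sqr_le.
have S3 : \sum_x 2 * (v * `|2 * pi * L th x| ^+ 3) <= 2 * (A * t / sg * t ^+ 2).
  rewrite t2 gauss_formE.
  have -> : 2 * (v / 2 * \sum_x (2 * pi * L th x) ^+ 2) = \sum_x v * `|2 * pi * L th x| ^+ 2.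
    rewrite !mulr_sumr; apply: eq_bigr => x _; rewrite real_normK ?num_real //; by field.
  rewrite !mulr_sumr; apply: ler_sum => x _.
  have hW : 0 <= v * `|2 * pi * L th x| ^+ 2 by rewrite mulr_ge0 ?exprn_ge0 // ltW.
  have := ler_wpM2r hW (ub x).
  rewrite [_ ^+ 3]exprSr; lra.
apply: (le_trans (ler_wpM2r (expR_ge0 _) S3)).
have -> : expR (- ((1 - (4 * r)^-1) * gauss_form th)) =
   expR (- (gauss_form th / (4 * r))) * expR (- (lam * gauss_form th)).
  by rewrite -expRD; congr expR; field; rewrite lt0r_neq0.
rewrite [leLHS]mulrA ler_wpM2r ?expR_ge0 //.
have g0 := gauss_form_ge0 th.
set s := gauss_form th / (4 * r).
have s0 : 0 <= s by rewrite divr_ge0 //; lra.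
have gs : gauss_form th = 4 * r * s by rewrite /s; field; rewrite lt0r_neq0.
have e1 : 1 <= expR s by have := expR_ge1Dx s; lra.
have e2 := expR_ge_sqr s0.
(* t ^ 3 is at most 1 + t ^ 4, and t ^ 4 is quadratic in the exponent s. *)
have t3 : t ^+ 3 <= 129 * r ^+ 2 * expR s.
  have : t ^+ 3 <= 1 + (t ^+ 2) ^+ 2.
    have [t1|t1] := leP t 1.
      by apply: (@le_trans _ _ 1); [exact: exprn_ile1 | rewrite lerDl sqr_ge0].
    rewrite -exprM; apply: (@le_trans _ _ (t ^+ 4)); last by rewrite lerDr.
    by rewrite ler_weXn2l // ltW.
  rewrite t2 gs => /le_trans; apply.
  have -> : (2 * (4 * r * s)) ^+ 2 = 128 * r ^+ 2 * (s ^+ 2 / 2) by field.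
  have := rn 2; have := ler_wpM2l (_ : 0 <= 128 * r ^+ 2) e2.
  rewrite mulr_ge0 ?exprn_ge0 // => /(_ isT); nra.
rewrite expRN ler_pdivrMr ?expR_gt0 //.
have -> : 2 * (A * t / sg * t ^+ 2) = 2 * A * t ^+ 3 / sg by field; rewrite lt0r_neq0.
rewrite [leRHS]mulrAC ler_pM2r ?invr_gt0 //.
apply: (le_trans (ler_wpM2l (_ : 0 <= 2 * A) t3)); first by lra.
rewrite [leLHS]mulrA ler_pM2r ?expR_gt0 //.
have -> : r ^+ 5 = r ^+ 2 * r ^+ 3 by rewrite -exprD.
have hA : A <= A ^+ 2 by rewrite expr2; nra.
have := rn 2; have := rn 3.
move: (r ^+ 2) (r ^+ 3) => X X' h1 h2.
have : A * X <= A ^+ 2 * X by rewrite ler_pM2r //; lra.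
have : A ^+ 2 * X <= A ^+ 2 * (X * X') by rewrite ler_pM2l; nra.
nra.
Qed.

Lemma normc_chf th : normc (chf f p th) <= expR (- (2 * v * \sum_x `|sin (pi * L th x)| ^+ 2)).
Proof.
rewrite /chf normc_prod mulr_sumr -sumrN expR_sum; apply: ler_prod => x _.
apply/andP; split; first by case: (psi _ _) => a b; exact: sqrtr_ge0.
apply: (le_trans (normc_psi_le _ p01')); rewrite ler_expR lerN2.
rewrite real_normK ?num_real // sin2cos2.
have -> : 2 * pi * L th x = (pi * L th x) *+ 2 by rewrite mulr2n; ring.
by rewrite cos_mulr2n le_eqVlt; apply/orP; left; apply/eqP; rewrite mulr2n; ring.
Qed.

(** Some coordinate of th is at least 1 / (8 r ^ 2) away from the integers, so
by h_sin the values of the linear form are on average at least of order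
1 / (A r ^ 2) away from them. *)
Lemma far_chf th : (forall w, `|th w| <= 1 / 2) -> (exists w, (8 * r ^+ 2)^-1 < `|th w|) ->
  normc (chf f p th) <= expR (- (s2 / D)).
Proof.
move=> hsm [w hw].
apply: (le_trans (normc_chf th)); rewrite ler_expR lerN2.
have r0 : 0 < r by apply: lt_le_trans r1.
have A0 : 0 < A by apply: lt_le_trans A1.
have h1 := sin_half (hsm w).
have h2 := h_sin th w.
have h3 : (16 * r ^+ 2)^-1 <= `|sin (pi * th w)|.
  have -> : (16 * r ^+ 2)^-1 = (8 * r ^+ 2)^-1 / 2 by field; rewrite lt0r_neq0.
  lra.
(* The sine loses a factor 2 against the distance to the integers. *)
have h4 : q * (16 * r ^+ 2)^-1 <= A * \sum_x `|sin (pi * L th x)|.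
  by apply: le_trans h2; rewrite ler_wpM2l ?ler0n.
have := sqr_avg _ h4; rewrite invr_ge0 mulr_ge0 ?exprn_ge0 // => /(_ isT) h5.
have -> : \sum_x `|sin (pi * L th x)| ^+ 2 = \sum_x sin (pi * L th x) ^+ 2.
  by apply: eq_bigr => x _; rewrite real_normK ?num_real.
move: h5; set S := \sum_x _ ^+ 2 => h5.
rewrite ler_pdivrMr //.
have -> : s2 = 256 * r ^+ 4 * v * (q * (16 * r ^+ 2)^-1 ^+ 2) by field; rewrite lt0r_neq0.
have -> : 2 * v * S * D = 256 * r ^+ 4 * v * (A ^+ 2 * S) by ring.
apply: (ler_wpM2l _ h5); apply: mulr_ge0 (ltW v0).
exact: mulr_ge0 (ler0n _ 256) (exprn_ge0 4 (ltW r0)).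
Qed.

(** As in far_chf, with the absolute value in place of the distance to the
integers. The part 1 - lam of the exponent gives the small factor, the part lam
is kept to be summed over the whole grid. *)
Lemma far_gauss th : (exists w, (8 * r ^+ 2)^-1 < `|th w|) ->
  expR (- gauss_form th) <= r * D / s2 * expR (- (lam * gauss_form th)).
Proof.
move=> [w hw].
have r0 : 0 < r by apply: lt_le_trans r1.
have A0 : 0 < A by apply: lt_le_trans A1.
have h4 : q * (8 * r ^+ 2)^-1 <= A * \sum_x `|L th x|.
  by apply: le_trans (h_abs th w); rewrite ler_wpM2l ?ler0n // ltW.
have := sqr_avg _ h4; rewrite invr_ge0 mulr_ge0 ?exprn_ge0 // => /(_ isT) h5.
have gS : gauss_form th = 2 * pi ^+ 2 * v * \sum_x L th x ^+ 2.
  rewrite gauss_formE.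
  have -> : \sum_x (2 * pi * L th x) ^+ 2 = (2 * pi) ^+ 2 * \sum_x L th x ^+ 2.
    by rewrite mulr_sumr; apply: eq_bigr => y _; rewrite exprMn.
  by field.
have -> : expR (- gauss_form th) = expR (- (gauss_form th / (2 * r))) * expR (- (lam * gauss_form th)).
  by rewrite -expRD; congr expR; field; rewrite lt0r_neq0.
rewrite ler_wpM2r ?expR_ge0 //.
have hx : s2 / (r * D) <= gauss_form th / (2 * r).
  rewrite gS; move: h5; set S := \sum_x _ => h5.
  have -> : s2 / (r * D) = 64 * r ^+ 4 * v * (q * (8 * r ^+ 2)^-1 ^+ 2) / (r * D).
    by congr (_ / _); field; rewrite lt0r_neq0.
  have : 64 * r ^+ 4 * v * (q * (8 * r ^+ 2)^-1 ^+ 2) <= 64 * r ^+ 4 * v * (A ^+ 2 * S).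
    by rewrite ler_wpM2l // mulr_ge0 ?(ltW v0) // mulr_ge0 ?exprn_ge0.
  have rD : 0 < (r * D)^-1 by rewrite invr_gt0 mulr_gt0.
  rewrite -(ler_pM2r rD) => /le_trans; apply.
  have S0 : 0 <= S by apply: sumr_ge0 => x _; exact: sqr_ge0.
  have -> : 64 * r ^+ 4 * v * (A ^+ 2 * S) / (r * D) = v * S / (2 * r).
    by field; rewrite !lt0r_neq0.
  rewrite ler_pM2r ?invr_gt0 ?mulr_gt0 //.
  have pp : 1 <= 2 * pi ^+ 2 :> R by have := pi_ge2 R; nra.
  rewrite -[2 * pi ^+ 2 * v * S]mulrA ler_peMl //.
  by rewrite mulr_ge0 // ltW.
have x0 : 0 < s2 / (r * D) by rewrite divr_gt0 // mulr_gt0.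
apply: (le_trans (_ : _ <= expR (- (s2 / (r * D))))); first by rewrite ler_expR lerN2.
by apply: (le_trans (expRN_le_inv x0)); rewrite invf_div.
Qed.

(** The integral of exp (- gauss_form th), the triangular change of variables
having determinant 1. *)
Definition gauss_mass : R := \prod_u Num.sqrt (pi / gauss_coef u).

Let g0 u : 0 < gauss_coef u.
Proof.
have /andP[d0 _] := hd u; rewrite /gauss_coef; do 3 apply: mulr_gt0 => //.
by rewrite exprn_gt0 // pi_gt0.
Qed.

Lemma gauss_mass_gt0 : 0 < gauss_mass.
Proof. by apply: prodr_gt0 => u _; rewrite sqrtr_gt0 divr_gt0 ?pi_gt0. Qed.

(** gauss_mass is at least (8 s2) ^ (- r / 2), and the exponential of s2 / D
beats this power once s2 exceeds Y ^ 2. *)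
Lemma far_weight_le : expR (- (s2 / D)) <= gauss_mass / Num.sqrt s2.
Proof.
have r0 : 0 < r by apply: lt_le_trans r1.
have A0 : 0 < A by apply: lt_le_trans A1.
have sg0 : 0 < Num.sqrt s2 by rewrite sqrtr_gt0.
rewrite ler_pdivlMr // expRN mulrC ler_pdivrMr ?expR_gt0 //.
have h1 : (Num.sqrt (8 * s2)) ^- #|W| <= gauss_mass.
  rewrite -prodr_const -prodfV; apply: ler_prod => u _.
  have /andP[d0 dq] := hd u.
  have vd : 0 < v * d u := mulr_gt0 v0 d0.
  have s8 : 0 < 8 * s2 by apply: mulr_gt0.
  have pvd : 0 < 2 * pi * (v * d u) by apply: mulr_gt0 => //; rewrite mulr_gt0 ?pi_gt0.
  rewrite invr_ge0 sqrtr_ge0 /= -sqrtrV ?(ltW s8) //.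
  have -> : pi / gauss_coef u = (2 * pi * (v * d u))^-1.
    rewrite /gauss_coef; move: (p * (1 - p)) v0 (d u) d0 (pi : R) (pi_gt0 R) => v' v'0 d' d'0 pi' pi'0.
    by field; rewrite !lt0r_neq0.
  rewrite ler_sqrt ?invr_ge0 ?(ltW pvd) //.
  rewrite lef_pV2 ?posrE //.
  have : v * d u <= s2 by rewrite ler_pM2l.
  have := pihalf_lt2 R; have := pi_gt0 R.
  by move: (v * d u) s2 vd => X Y' X0; nra.
apply: (le_trans _ (ler_wpM2r (expR_ge0 _) h1)).
have z0 : 0 < Num.sqrt (8 * s2) by rewrite sqrtr_gt0; apply: mulr_gt0.
rewrite [leRHS]mulrC ler_pdivlMr; last by rewrite exprn_gt0.
set z := Num.sqrt (8 * s2).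
have z1 : 1 <= z by rewrite -[leLHS]sqrtr1 ler_sqrt ?mulr_gt0 //; have := s21; lra.
have z2 : z ^+ 2 = 8 * s2 by rewrite sqr_sqrtr // mulr_ge0 // ltW.
(* The exponent is doubled to turn the square root z into 8 * s2. *)
apply: (@le_trans _ _ (z ^+ #|W|.+1)).
  rewrite exprS ler_wpM2r ?exprn_ge0 ?sqrtr_ge0 //.
  by rewrite ler_sqrt ?mulr_gt0 //; have := s20; lra.
apply: (@le_trans _ _ ((z ^+ 2) ^+ #|W|)).
  by rewrite -exprM; apply: ler_weXn2l => //; rewrite mul2n -addnn -addn1 leq_add2l.
have -> : s2 / D = r * (s2 / (r * D)) by field; rewrite !lt0r_neq0.
rewrite expRM_natl lerXn2r // ?nnegrE ?expR_ge0 ?sqr_ge0 // z2.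
have x0 : 0 <= s2 / (r * D) := divr_ge0 (ltW s20) (mulr_ge0 (ltW r0) (ltW D0)).
apply: le_trans (expR_ge_sqr x0).
have Yr : Y = 4 * (r * D) by ring.
have rD : 0 < r * D by rewrite mulr_gt0.
move: hs2; rewrite Yr exprMn expr_div_n => h.
rewrite [leRHS]mulrAC ler_pdivlMr; last by rewrite exprn_gt0.
have := ler_wpM2l (ltW s20) h; rewrite expr2; lra.
Qed.

Let lam12 : 1 / 2 <= lam < 1.
Proof.
have r0 : 0 < r by apply: lt_le_trans r1.
have : 0 < (2 * r)^-1 by rewrite invr_gt0 mulr_gt0.
have : (2 * r)^-1 <= 2^-1 by rewrite lef_pV2 ?posrE ?mulr_gt0 // ler_peMr.
by move: (2 * r)^-1 => X h1 h2; apply/andP; split; lra.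
Qed.

(** The factor lost by summing the gaussian with exponent lam is bounded; this
is why 1 - lam is of order 1 / r. *)
Lemma lam_pow : (Num.sqrt lam) ^- #|W| <= 2.
Proof.
have r0 : 0 < r by apply: lt_le_trans r1.
have /andP[l0 l1] := lam12.
have lp : 0 < lam by apply: lt_le_trans l0.
have h : 1 / 2 <= lam ^+ #|W|.
  apply: le_trans (bernoulli #|W| _); last first.
    by move: l0 l1; move: (2 * r)^-1 => X h1 h2; apply/andP; split; lra.
  have -> : r * (2 * r)^-1 = 1 / 2 by field; rewrite lt0r_neq0.
  lra.
have h2 : (Num.sqrt lam ^+ #|W|) ^+ 2 = lam ^+ #|W|.
  by rewrite -exprM mulnC exprM sqr_sqrtr // ltW.
have x0 : 0 < Num.sqrt lam ^+ #|W| by rewrite exprn_gt0 // sqrtr_gt0.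
rewrite -[leRHS]invrK lef_pV2 ?posrE ?invr_gt0 //.
move: h x0; rewrite -h2; move: (Num.sqrt lam ^+ #|W|) => X; nra.
Qed.

Section Sum.
Variables (m m' : nat).
Hypothesis mm' : (m <= m')%N.
Hypothesis m4 : (4 * #|B|.+1 <= m)%N.

Local Notation M := ((m.*2.+1)%:R : R).
Local Notation c0 := (M^-1 ^+ #|W|).
Local Notation V := (fun (th : {ffun W -> 'I_(m'.*2.+1)}) w => @grid_val R m m' (th w)).

Let M0 : 0 < M. Proof. by rewrite ltr0n. Qed.
Let eM : M = m%:R + m%:R + 1. Proof. by rewrite -natr1 -addnn natrD. Qed.

Lemma grid_prod (l : R) (th : {ffun W -> 'I_(m'.*2.+1)}) :
  \prod_u (M^-1 * expR (- (l * gauss_coef u * tri_coord (@grid_val R m m') rho C th u ^+ 2))) =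
  c0 * expR (- (l * gauss_form (V th))).
Proof.
rewrite big_split /= prodr_const -expR_sum; congr (_ * expR _).
by rewrite sumrN /gauss_form mulr_sumr; congr (- _); apply: eq_bigr => u _; rewrite mulrA.
Qed.

Lemma cube_half (th : {ffun W -> 'I_(m'.*2.+1)}) w : in_cube m th -> `|V th w| <= 1 / 2.
Proof.
move=> /forallP /(_ w) /andP[h1 h2]; rewrite /grid_val normrM normfV (gtr0_norm M0).
rewrite ler_pdivrMr // eM.
have h3 : ((m' - m)%N%:R : R) <= (th w)%:R by rewrite ler_nat.
have h4 : ((th w)%:R : R) <= (m' + m)%N%:R by rewrite ler_nat.
rewrite natrB // in h3; rewrite natrD in h4.
by rewrite ler_norml; apply/andP; split; lra.
Qed.

Lemma near_in_cube (th : {ffun W -> 'I_(m'.*2.+1)}) :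
  (forall w, `|V th w| <= (8 * r ^+ 2)^-1) -> in_cube m th.
Proof.
move=> near; apply/forallP => w; have := near w.
have h8 : (8 * r ^+ 2)^-1 <= 8^-1.
  have r8 : 0 < 8 * r ^+ 2 by apply: mulr_gt0 => //; apply: lt_le_trans (rn 2).
  by rewrite lef_pV2 ?posrE // ler_peMr.
move=> /le_trans /(_ h8); rewrite /grid_val normrM normfV (gtr0_norm M0).
rewrite ler_pdivrMr // eM => h.
have m1 : 1 <= (m%:R : R) by rewrite ler1n (leq_trans _ m4).
have {}h : `|(th w)%:R - m'%:R| <= (m%:R : R) by apply: (le_trans h); lra.
move: h; rewrite ler_norml => /andP[h1 h2].
rewrite /in_window leq_subLR -!(ler_nat R) !natrD.
by apply/andP; split; lra.
Qed.

Lemma sum_cube : \sum_(th : {ffun W -> 'I_(m'.*2.+1)} | in_cube m th) c0 = 1.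
Proof.
transitivity (\prod_(w : W) \sum_(k < m'.*2.+1 | in_window m m' k) M^-1).
  rewrite bigA_distr_big; apply: eq_big => [th|th _]; last by rewrite prodr_const.
  by apply/forallP/ffun_onP => h w; exact: h.
rewrite big1 // => w _.
rewrite (sum_window (fun=> M^-1) mm') sumr_const card_ord -[M^-1 *+ _]mulr_natl mulfV //.
Qed.

(** The grid points are near, far inside the cube, or outside the cube; each
contributes to one of the three terms. *)
Lemma prob_hit_gauss_sum (SG SL : R) :
  SG = \sum_(th : {ffun W -> 'I_(m'.*2.+1)}) c0 * expR (- gauss_form (V th)) ->
  SL = \sum_(th : {ffun W -> 'I_(m'.*2.+1)}) c0 * expR (- (lam * gauss_form (V th))) ->
  `|prob_hit f p E - SG| <= Y / Num.sqrt s2 * SL + expR (- (s2 / D)) + r * D / s2 * SL.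
Proof.
move=> eSG eSL.
have c00 : 0 <= c0 by rewrite exprn_ge0 // invr_ge0 ltW.
have nc (x : R) (z : R[i]) : 0 <= x -> normc (x%:C * z) = x * normc z.
  by move=> x0; rewrite normcM normc_real ger0_norm.
have a0 : 0 <= Y / Num.sqrt s2 := divr_ge0 (le_trans ler01 Y1) (sqrtr_ge0 _).
have b0 : 0 <= r * D / s2 := divr_ge0 (mulr_ge0 (ler0n _ _) (ltW D0)) (ltW s20).
move: near_bound far_gauss far_chf (expR_ge0 (- (s2 / D))).
move: (Y / Num.sqrt s2) (r * D / s2) (expR (- (s2 / D))) a0 b0 => y z t a0 b0 nearB farG farC t0.
have m4' : (4 * #|B| <= m.*2.+1)%N.
  rewrite -addnn (leq_trans _ (leq_trans m4 _)) ?leq_mul2l ?leqnSn //.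
  by rewrite ltnW // ltnS leq_addr.
rewrite -normc_real.
have -> : (prob_hit f p E - SG)%:C = (prob_hit f p E)%:C - SG%:C by rewrite rmorphB.
rewrite (prob_hitE hE p01' mm' m4').
rewrite big_mkcond /=.
have -> : SG%:C = \sum_(th : {ffun W -> 'I_(m'.*2.+1)}) (c0%:C * (expR (- gauss_form (V th)))%:C).
  rewrite eSG (big_morph (fun x : R => x%:C) (id1 := 0) (op1 := +%R)) //; last by move=> ? ?; rewrite rmorphD.
  by apply: eq_bigr => th _; rewrite rmorphM.
rewrite -sumrB; apply: (le_trans (normc_sum _ _ _)).
have -> : t = \sum_(th : {ffun W -> 'I_(m'.*2.+1)}) (if in_cube m th then c0 * t else 0).
  by rewrite -big_mkcond -mulr_suml sum_cube mul1r.
rewrite eSL !mulr_sumr /= -!big_split /=.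
apply: ler_sum => th _.
have e0 := expR_ge0 (- (lam * gauss_form (V th))).
case: (boolP [forall w, `|V th w| <= (8 * r ^+ 2)^-1]) => [/forallP near|].
  rewrite (near_in_cube near) -mulrBr nc //.
  have hn := ler_wpM2l c00 (nearB _ near); rewrite [leRHS]mulrCA in hn.
  have h1 : 0 <= c0 * t by rewrite mulr_ge0.
  have h2 : 0 <= z * (c0 * expR (- (lam * gauss_form (V th)))) by rewrite !mulr_ge0.
  apply: (le_trans hn).
  by rewrite -addrA lerDl addr_ge0.
rewrite negb_forall => /existsP [w]; rewrite -ltNge => hw.
have ex : exists w, (8 * r ^+ 2)^-1 < `|V th w| by exists w.
have h2 := ler_wpM2l c00 (farG _ ex).
have h0 : 0 <= y * (c0 * expR (- (lam * gauss_form (V th)))) by rewrite !mulr_ge0.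
apply: (le_trans (le_normcD _ _)); rewrite normcN.
rewrite [X in _ + X <= _]nc // normc_real (ger0_norm (expR_ge0 _)).
apply: lerD; last by rewrite [leRHS]mulrCA.
case: ifP => sm.
  have h1 := ler_wpM2l c00 (farC _ (fun w => cube_half w sm) ex).
  by rewrite nc // (le_trans h1) // lerDr.
by rewrite normc0 addr0.
Qed.
End Sum.

Theorem local_limit :
  `|prob_hit f p E - gauss_mass| <= 10 * Y / Num.sqrt s2 * gauss_mass.
Proof.
set sg := Num.sqrt s2.
have r0 : 0 < r by apply: lt_le_trans r1.
have sg1 : 1 <= sg := sig1.
have sg0 : 0 < sg by apply: lt_le_trans sg1.
have G0 := gauss_mass_gt0.
(* An error e per variable of the grid sums adds up to about 1 / sg. *)
pose e : R := (4 * r * sg)^-1.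
have e0 : 0 < e by rewrite invr_gt0 !mulr_gt0.
have re : r * e = (4 * sg)^-1 by rewrite /e; field; rewrite !lt0r_neq0.
have sgV : 0 < sg^-1 <= 1 by rewrite invr_gt0 sg0 invf_le1.
have re4 : r * e <= 1 / 4 by rewrite re invfM; lra.
have e1 : e <= 1 by have := r1; nra.
have e01 : 0 < e <= 1 by rewrite e0.
have [m [m' [m4 mm' up lo]]] := gauss_grid rho C (4 * #|B|.+1) g0 e01.
set c0 : R := ((m.*2.+1)%:R^-1) ^+ #|W|.
pose V (th : {ffun W -> 'I_(m'.*2.+1)}) w := @grid_val R m m' (th w).
pose SG := \sum_th c0 * expR (- gauss_form (V th)).
pose SL := \sum_th c0 * expR (- (lam * gauss_form (V th))).
have /andP[l0 l1] := lam12.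
have lp : 0 < lam by apply: lt_le_trans l0.
have eSG : \sum_(th : {ffun W -> 'I_(m'.*2.+1)}) \prod_u
    ((m.*2.+1)%:R^-1 * expR (- (gauss_coef u * tri_coord (@grid_val R m m') rho C th u ^+ 2))) = SG.
  apply: eq_bigr => th _; rewrite -[gauss_form _]mul1r -grid_prod.
  by apply: eq_bigr => u _; rewrite mul1r.
have eSL : \sum_(th : {ffun W -> 'I_(m'.*2.+1)}) \prod_u
    ((m.*2.+1)%:R^-1 * expR (- (lam * gauss_coef u * tri_coord (@grid_val R m m') rho C th u ^+ 2))) = SL.
  by apply: eq_bigr => th _; exact: grid_prod.
have re0 : 0 <= r * e by rewrite mulr_ge0 ?(ltW r0) ?(ltW e0).
have h2 := @bernoulli R e #|W| (introT andP (conj (ltW e0) e1)).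
have re2 : r * e <= 1 / 2 by move: (r * e) re4 => X; lra.
have h3 := expr1D_le (ltW e0) re2.
have SGle : SG <= (1 + 2 * (r * e)) * gauss_mass.
  have := up gauss_coef (fun i => introT andP (conj (g0 i) (lexx _))).
  rewrite eSG big_split /= prodr_const -/gauss_mass => /le_trans; apply.
  by rewrite ler_wpM2r // ltW.
have SGge : (1 - r * e) * gauss_mass <= SG.
  move: lo; rewrite eSG big_split /= prodr_const -/gauss_mass; apply: le_trans.
  by rewrite ler_wpM2r // ltW.
have SLle : SL <= 4 * gauss_mass.
  have := up (fun u => lam * gauss_coef u) _; rewrite eSL => h.
  apply: (le_trans (h _)) => [i|].
    by rewrite mulr_gt0 //= ler_piMl ?(ltW l1) ?(ltW (g0 i)).
  have -> : \prod_i ((1 + e) * Num.sqrt (pi / (lam * gauss_coef i))) =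
     (1 + e) ^+ #|W| * ((Num.sqrt lam) ^- #|W| * gauss_mass).
    rewrite big_split /= prodr_const; congr (_ * _).
    rewrite -prodr_const -prodfV -big_split /=; apply: eq_bigr => u _.
    rewrite invfM mulrCA sqrtrM ?invr_ge0 ?(ltW lp) // sqrtrV //; exact: ltW.
  rewrite mulrA ler_wpM2r ?(ltW G0) //.
  have : (1 + e) ^+ #|W| <= 2 by apply: (le_trans h3); move: (r * e) re2 => X; lra.
  have : 0 <= (1 + e) ^+ #|W| by rewrite exprn_ge0 // addr_ge0 // ltW.
  have : 0 <= Num.sqrt lam ^- #|W| by rewrite invr_ge0 exprn_ge0 ?sqrtr_ge0.
  move: lam_pow; move: (_ ^- _) ((1 + e) ^+ _) => X X'; nra.
have main := prob_hit_gauss_sum mm' m4 (erefl SG) (erefl SL).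
have t1 := far_weight_le.
have y1 : sg^-1 <= Y / sg by rewrite -[leLHS]mul1r ler_wpM2r ?(ltW (_ : 0 < sg^-1)) ?invr_gt0 // Y1.
have z1 : r * D / s2 <= (Y / sg) / 4.
  have -> : s2 = sg * sg by rewrite -expr2 sqr_sqrtr // ltW.
  have -> : r * D / (sg * sg) = (Y / sg / 4) * sg^-1 by field; rewrite lt0r_neq0.
  apply: ler_piMr; last by rewrite invf_le1.
  exact: divr_ge0 (divr_ge0 (le_trans ler01 Y1) (ltW sg0)) (ler0n _ 4).
rewrite -/sg in main t1.
have SL0 : 0 <= SL.
  by apply: sumr_ge0 => th _; rewrite mulr_ge0 ?expR_ge0 // exprn_ge0 // invr_ge0.
rewrite re invfM in SGle SGge.
have -> : 10 * Y / sg * gauss_mass = 10 * (Y / sg) * gauss_mass by rewrite -!mulrA.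
have yG := ler_wpM2r (ltW G0) y1.
have tG : gauss_mass / sg <= (Y / sg) * gauss_mass by rewrite [leLHS]mulrC.
have y0 : 0 <= Y / sg := divr_ge0 (le_trans ler01 Y1) (ltW sg0).
have ySL := ler_wpM2l y0 SLle.
have zSL : r * D / s2 * SL <= (Y / sg) / 4 * (4 * gauss_mass).
  apply: ler_pM => //; exact: divr_ge0 (mulr_ge0 (ler0n _ _) (ltW D0)) (ltW s20).
move: main t1 ySL zSL tG y0 yG SGle SGge.
move: (Y / sg) (r * D / s2 * SL) (expR _) => y z t.
move: (sg^-1) => k h t1 ySL zSL tG y0 yG SGle SGge.
have -> : prob_hit f p E - gauss_mass = (prob_hit f p E - SG) + (SG - gauss_mass) by ring.
apply: (le_trans (ler_normD _ _)).
have yG0 := mulr_ge0 y0 (ltW G0).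
have h5 : `|SG - gauss_mass| <= y * gauss_mass.
  by rewrite ler_norml; apply/andP; split; lra.
lra.
Qed.
End LLT.

(** * An orthogonal basis of the functions of one letter *)

Section Letters.
Context {R : realType}.
Variable k : nat.
Local Notation letter := 'I_k.+1.

(** The factor at one position of the indicator that a word agrees with w
wherever w is nonzero: a is the letter of w, b that of the word. *)
Definition letter_test (a b : letter) : R := ((a == ord0) || (b == a))%:R.

(** Gram-Schmidt applied to the constant function, then to the indicators of
the letters k, ..., 1 in this order. *)
Definition letter_orth (a b : letter) : R :=
  if a == ord0 then 1 else (b == a)%:R - (b <= a)%N%:R / (a%:R + 1).

(** The coordinates of letter_test a in the basis letter_orth. *)
Definition letter_coef (b a : letter) : R :=
  if b == ord0 then (if a == ord0 then 1 else (k.+1%:R)^-1)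
  else if (a == ord0) || (b < a)%N then 0
  else if b == a then 1 else - (b%:R)^-1.
Definition letter_sqnorm (a : letter) : R := if a == ord0 then k.+1%:R else a%:R / (a%:R + 1).

Lemma sum_le_letter (a : letter) : \sum_(b : letter) (b <= a)%N%:R = a%:R + 1 :> R.
Proof.
rewrite -natr_sum natr1; congr _%:R.
under eq_bigr do rewrite -ltnS.
rewrite -big_mkcond /= -(big_ord_widen k.+1 (fun _ => 1%N) (ltn_ord a)).
by rewrite sum1_card card_ord.
Qed.

Lemma letter_orth0 b : letter_orth ord0 b = 1. Proof. by rewrite /letter_orth eqxx. Qed.

Lemma sum_letter_orth (a : letter) : a != ord0 -> \sum_b letter_orth a b = 0.
Proof.
move=> a0; rewrite /letter_orth (negbTE a0) sumrB -mulr_suml sum_le_letter divff.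
  by rewrite -natr_sum -big_mkcond /= (big_pred1 a) // subrr.
by rewrite natr1 pnatr_eq0.
Qed.

Lemma letter_orth_gt (a b : letter) : a != ord0 -> (a < b)%N -> letter_orth a b = 0.
Proof.
move=> a0 ab; rewrite /letter_orth (negbTE a0) leqNgt ab /= mul0r subr0.
by case: eqP ab => // ->; rewrite ltnn.
Qed.

Lemma letter_orth_lt (a b : letter) : (b < a)%N -> letter_orth a b = - (a%:R + 1)^-1.
Proof.
move=> ba; have a0 : a != ord0 by apply/eqP => a0; rewrite a0 in ba.
rewrite /letter_orth (negbTE a0) (ltnW ba) mul1r; case: eqP => [e|_]; last by rewrite sub0r.
by rewrite e ltnn in ba.
Qed.

Lemma letter_orth_diag (a : letter) : a != ord0 -> letter_orth a a = letter_sqnorm a.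
Proof.
move=> a0; rewrite /letter_orth /letter_sqnorm (negbTE a0) eqxx leqnn /=.
by field; rewrite natr1 pnatr_eq0.
Qed.

(** If a is 0 this is the vanishing of the mean of the other function.
Otherwise the function of b is constant on the support of that of a, which has
mean 0. *)
Lemma letter_orth_dot_lt (a b : letter) : (a < b)%N -> \sum_x letter_orth a x * letter_orth b x = 0.
Proof.
move=> ab; have b0 : b != ord0 by apply/eqP => b0; rewrite b0 in ab.
case: (eqVneq a ord0) => [->|a0].
  by under eq_bigr do rewrite letter_orth0 mul1r; exact: sum_letter_orth.
transitivity (\sum_x letter_orth a x * - (b%:R + 1)^-1); last by rewrite -mulr_suml sum_letter_orth ?mul0r.
apply: eq_bigr => x _; have [xa|ax] := leqP x a.
  by rewrite (letter_orth_lt (leq_ltn_trans xa ab)).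
by rewrite letter_orth_gt ?mul0r.
Qed.

Lemma letter_orth_dot (a b : letter) : \sum_x letter_orth a x * letter_orth b x = (a == b)%:R * letter_sqnorm a.
Proof.
case: (ltngtP a b) => [ab|ba|/val_inj ab].
- by rewrite letter_orth_dot_lt // -val_eqE ltn_eqF // mul0r.
- under eq_bigr do rewrite mulrC.
  by rewrite letter_orth_dot_lt // -val_eqE gtn_eqF // mul0r.
rewrite -ab eqxx mul1r.
case: (eqVneq a ord0) => [->|a0].
  under eq_bigr do rewrite letter_orth0 mul1r.
  by rewrite sumr_const card_ord /letter_sqnorm eqxx.
transitivity (\sum_x letter_orth a x * ((x == a)%:R - (a%:R + 1)^-1)).
  apply: eq_bigr => x _; have [xa|ax] := leqP x a.
    by rewrite {2}/letter_orth (negbTE a0) xa mul1r.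
  by rewrite letter_orth_gt ?mul0r.
under eq_bigr do rewrite mulrBr.
rewrite sumrB -mulr_suml sum_letter_orth // mul0r subr0 (bigD1 a) //= eqxx mulr1 letter_orth_diag // big1 ?addr0 //.
by move=> x /negbTE ->; rewrite mulr0.
Qed.

Lemma sum_inv_telescope (s : nat) : (s <= k)%N ->
  \sum_(b < k.+1 | (s < b)%N) (b%:R)^-1 * (b%:R + 1)^-1 = (s%:R + 1)^-1 - (k.+1%:R)^-1 :> R.
Proof.
move=> sk; rewrite -(big_mkord (fun b => (s < b)%N) (fun b => (b%:R)^-1 * (b%:R + 1)^-1)).
rewrite -(big_nat_widenl s.+1 0 k.+1 xpredT) //.
pose u (j : nat) : R := - (j%:R)^-1.
rewrite -(eq_big_nat _ _ (F1 := fun i => u i.+1 - u i)).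
  rewrite telescope_sumr // /u opprK addrC; congr (_ - _); by rewrite natr1.
move=> i /andP[si ik]; rewrite /u -natr1; field.
by rewrite natr1 !pnatr_eq0 /=; case: i si ik.
Qed.

(** Beyond the diagonal the coefficients are - 1 / b, and the sums of
1 / (b (b + 1)) telescope. *)
Lemma letter_test_expand (a x : letter) : letter_test a x = \sum_b letter_coef b a * letter_orth b x.
Proof.
have k0 : (k.+1%:R : R) != 0 by rewrite pnatr_eq0.
rewrite (bigD1 ord0) //= /letter_test.
case: (eqVneq a ord0) => [a0|a0] /=.
  rewrite big1 ?addr0.
    by rewrite /letter_coef a0 !eqxx /letter_orth eqxx mulr1.
  by move=> b b0; rewrite /letter_coef (negbTE b0) a0 eqxx mul0r.
rewrite {1}/letter_coef eqxx (negbTE a0) {1}/letter_orth eqxx mulr1.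
rewrite (bigD1 a) //= {1}/letter_coef (negbTE a0) ltnn eqxx mul1r.
have -> : \sum_(b : letter | (b != ord0) && (b != a)) letter_coef b a * letter_orth b x =
   \sum_(b : letter | (a < b)%N) - (b%:R)^-1 * letter_orth b x.
  rewrite [RHS]big_mkcond /= big_mkcond /=; apply: eq_bigr => b _.
  case: (eqVneq b ord0) => [->|b0] //=.
  rewrite /letter_coef (negbTE b0) (negbTE a0) /= -val_eqE.
  by case: (ltngtP b a) => //= _; rewrite mul0r.
case: (ltngtP x a) => [xa|ax|/val_inj xa].
- rewrite -val_eqE ltn_eqF //= letter_orth_lt //.
  have -> : \sum_(b : letter | (a < b)%N) - (b%:R)^-1 * letter_orth b x =
     \sum_(b : letter | (a < b)%N) (b%:R)^-1 * (b%:R + 1)^-1.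
    by apply: eq_bigr => b ab; rewrite letter_orth_lt ?(ltn_trans xa) // mulrNN.
  by rewrite sum_inv_telescope ?leq_ord //; ring.
- rewrite -val_eqE gtn_eqF //= letter_orth_gt //.
  have x0 : x != ord0 by apply/eqP => x0; rewrite x0 in ax.
  rewrite (bigID (fun b : letter => (b <= x)%N)) /=.
  have -> : \sum_(b : letter | (a < b)%N && (b <= x)%N) - (b%:R)^-1 * letter_orth b x = - (x%:R)^-1 * letter_orth x x.
    rewrite (bigD1 x) /= ?ax ?leqnn // big1 ?addr0 // => b /andP[/andP[ab bx] nbx].
    rewrite letter_orth_gt ?mulr0 //; last by rewrite ltn_neqAle nbx.
    by apply/eqP => b0; rewrite b0 in ab.
  have -> : \sum_(b : letter | (a < b)%N && ~~ (b <= x)%N) - (b%:R)^-1 * letter_orth b x =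
     \sum_(b : letter | (x < b)%N) (b%:R)^-1 * (b%:R + 1)^-1.
    apply: eq_big => [b|b /andP[_]]; rewrite -ltnNge.
      by case: (ltnP x b) => xb; rewrite ?andbF // (ltn_trans ax xb).
    by move=> xb; rewrite letter_orth_lt // mulrNN.
  rewrite sum_inv_telescope ?leq_ord // letter_orth_diag // /letter_sqnorm (negbTE x0).
  have x0' : (x%:R : R) != 0 by rewrite pnatr_eq0.
  by field; rewrite x0' nat1r natr1 !pnatr_eq0.
- rewrite xa eqxx /= letter_orth_diag //.
  have -> : \sum_(b : letter | (a < b)%N) - (b%:R)^-1 * letter_orth b a =
     \sum_(b : letter | (a < b)%N) (b%:R)^-1 * (b%:R + 1)^-1.
    by apply: eq_bigr => b ab; rewrite letter_orth_lt // mulrNN.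
  rewrite sum_inv_telescope ?leq_ord // /letter_sqnorm (negbTE a0).
  by field; rewrite nat1r natr1 !pnatr_eq0.
Qed.

(** The order in which letter_coef is triangular: 1 < 2 < ... < k < 0, the
letter 0 being last since the constant enters every expansion. *)
Definition letter_rank (a : letter) : nat := if a == ord0 then k else (a : nat).-1.

Lemma letter_coef_diag a : letter_coef a a = 1.
Proof. by rewrite /letter_coef ltnn eqxx; case: eqP. Qed.

Lemma letter_coef_neq0 (b a : letter) : letter_coef b a != 0 ->
  (b == a) || (letter_rank a < letter_rank b)%N.
Proof.
rewrite /letter_coef /letter_rank; case: (eqVneq b ord0) => [b0|b0]; case: (eqVneq a ord0) => [a0|a0] /=.
- by rewrite a0 b0 eqxx.
- move=> _; apply/orP; right; rewrite prednK ?leq_ord // lt0n.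
  by rewrite -val_eqE /= in a0.
- by rewrite eqxx.
have a1 : (0 < a)%N by rewrite lt0n.
have b1 : (0 < b)%N by rewrite lt0n.
case: ltngtP => [||/val_inj ->]; rewrite ?eqxx // => ab _.
by apply/orP; right; lia.
Qed.

Lemma letter_coef_supp (b a : letter) : letter_coef b a != 0 -> a = ord0 -> b = ord0.
Proof. by rewrite /letter_coef => + a0; rewrite a0 eqxx; case: (eqVneq b ord0) => //=; rewrite eqxx. Qed.

Lemma letter_sqnorm_gt0 a : 0 < letter_sqnorm a.
Proof.
rewrite /letter_sqnorm; case: (eqVneq a ord0) => a0; first by rewrite ltr0n.
by rewrite divr_gt0 ?natr1 ?ltr0n // lt0n.
Qed.

Lemma letter_sqnorm_le a : letter_sqnorm a <= k.+1%:R.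
Proof.
rewrite /letter_sqnorm; case: (eqVneq a ord0) => a0 //.
apply: (@le_trans _ _ 1); last by rewrite ler1n.
by rewrite natr1 ler_pdivrMr ?ltr0n // mul1r ler_nat.
Qed.

(** The product 1/2 * 2/3 * ... telescopes against the norm of the constant
function. *)
Lemma prod_letter_sqnorm : \prod_a letter_sqnorm a = 1.
Proof.
have h m : \prod_(0 <= a < m.+1) (if a == 0%N then 1 else a%:R / (a%:R + 1) : R) = (m.+1%:R)^-1.
  elim: m => [|m IH]; first by rewrite big_nat1 eqxx invr1.
  rewrite big_nat_recr //= IH natr1 mulrA mulVf ?mul1r // pnatr_eq0 //.
rewrite (bigD1 ord0) //= {1}/letter_sqnorm eqxx.
have -> : \prod_(a : letter | a != ord0) letter_sqnorm a =
  \prod_(0 <= a < k.+1) (if a == 0%N then 1 else a%:R / (a%:R + 1) : R).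
  rewrite big_mkord [RHS](bigD1 ord0) //= mul1r; apply: eq_bigr => a a0.
  have a0' : ((a : nat) == 0%N) = false by rewrite -(inj_eq val_inj) /= in a0; exact: negbTE.
  by rewrite /letter_sqnorm (negbTE a0) a0'.
by rewrite h mulfV // pnatr_eq0.
Qed.
End Letters.

(** * Words of low weight and their orthogonal basis *)

Section Words.
Context {R : realType}.
Variables n k t : nat.
Local Notation letter := 'I_k.+1.
Local Notation word := {ffun 'I_n -> 'I_k.+1}.

Definition supp (w : word) : {set 'I_n} := [set i | w i != ord0].
Definition agree (S : {set 'I_n}) (v x : word) : bool := [forall i in S, x i == v i].

(** These words index the functions of degree at most t. *)
Definition low_weight : {set word} := [set w | (#|supp w| <= t)%N].
Local Notation W := {w : word | w \in low_weight}.

Lemma low_weight_le (w : W) : (#|supp (val w)| <= t)%N.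
Proof. by have := valP w; rewrite inE. Qed.

(** The indicator f_w evaluated at x. *)
Definition extends (w : W) (x : word) : bool := agree (supp (val w)) (val w) x.

Lemma extendsE (w : W) (x : word) : (extends w x)%:R = \prod_i letter_test (val w i) (x i) :> R.
Proof.
rewrite /extends /agree; case: (boolP [forall i in _, _]) => [/forall_inP h|].
  rewrite big1 // => i _; rewrite /letter_test.
  case: (eqVneq (val w i) ord0) => // wi.
  by have := h i; rewrite inE wi => /(_ isT) /eqP ->; rewrite eqxx orbT.
rewrite negb_forall_in => /exists_inP [i wi xi]; rewrite inE in wi.
by rewrite (bigD1 i) //= /letter_test (negbTE wi) (negbTE xi) mul0r.
Qed.

(** Tensor products of the one-letter basis. *)
Definition word_orth (u x : word) : R := \prod_i letter_orth (u i) (x i).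
Definition word_coef (u w : word) : R := \prod_i letter_coef (u i) (w i).
Definition word_sqnorm (u : word) : R := \prod_i letter_sqnorm (u i).
Definition word_rank (u : word) : nat := (\sum_i letter_rank (u i))%N.

Lemma prod_letter_test (w x : word) : \prod_i letter_test (w i) (x i) = \sum_u word_coef u w * word_orth u x.
Proof.
under eq_bigr do rewrite letter_test_expand.
rewrite bigA_distr_bigA /=; apply: eq_bigr => u _.
by rewrite big_split.
Qed.

Lemma word_orth_dot (u v : word) :
  \sum_x word_orth u x * word_orth v x = (u == v)%:R * word_sqnorm u.
Proof.
under eq_bigr do rewrite -big_split /=.
rewrite -(bigA_distr_bigA (fun i b => letter_orth (u i) b * letter_orth (v i) b)) /=.
under eq_bigr do rewrite letter_orth_dot.
rewrite big_split /=; congr (_ * _).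
case: (eqVneq u v) => [->|uv]; first by rewrite big1 // => i _; rewrite eqxx.
have [i uvi] : exists i, u i != v i.
  apply/existsP; apply: contraR uv => /existsPn h.
  by apply/eqP/ffunP => i; have := h i; rewrite negbK => /eqP.
by rewrite (bigD1 i) //= (negbTE uvi) mul0r.
Qed.

Lemma word_coef_diag u : word_coef u u = 1.
Proof. by rewrite /word_coef big1 // => i _; rewrite letter_coef_diag. Qed.

Lemma word_coef_neq0 u w i : word_coef u w != 0 -> letter_coef (u i) (w i) != 0 :> R.
Proof. by apply: contraNneq => h; rewrite /word_coef (bigD1 i) //= h mul0r. Qed.

(** The orthogonalisation does not enlarge supports, so it stays within the
functions of degree at most t. *)
Lemma word_coef_low (u : word) (w : W) : word_coef u (val w) != 0 -> (#|supp u| <= t)%N.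
Proof.
move=> h; apply: leq_trans (low_weight_le w); apply: subset_leq_card; apply/fintype.subsetP => i.
rewrite !inE; apply: contra => /eqP wi; apply/eqP.
exact: (letter_coef_supp (word_coef_neq0 i h)).
Qed.

(** Triangularity of a tensor product, from that of its factors. *)
Lemma word_coef_rank (u w : word) : word_coef u w != 0 -> u != w -> (word_rank w < word_rank u)%N.
Proof.
move=> h uw.
have le i : (letter_rank (w i) <= letter_rank (u i))%N.
  by have /orP[/eqP -> //|/ltnW] := letter_coef_neq0 (word_coef_neq0 i h).
have [i uwi] : exists i, u i != w i.
  apply/existsP; apply: contraR uw => /existsPn h'.
  by apply/eqP/ffunP => i; have := h' i; rewrite negbK => /eqP.
rewrite /word_rank (bigD1 i) //= [X in (_ < X)%N](bigD1 i) //= -addSn leq_add ?leq_sum //.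
by have := letter_coef_neq0 (word_coef_neq0 i h); rewrite (negbTE uwi).
Qed.

Lemma extends_expand (w : W) x :
  (extends w x)%:R = \sum_(u : W) word_coef (val u) (val w) * word_orth (val u) x.
Proof.
rewrite extendsE prod_letter_test (bigID (mem low_weight)) /= [X in _ + X]big1 ?addr0; first exact: big_sub.
move=> u; rewrite inE => uh; case: (eqVneq (word_coef u (val w)) 0) => [->|/word_coef_low h].
  by rewrite mul0r.
by rewrite h in uh.
Qed.

Lemma lin_expand (th : W -> R) x :
  lin extends th x = \sum_u word_orth (val u) x *
     (th u + \sum_(w : W | (word_rank (val w) < word_rank (val u))%N) word_coef (val u) (val w) * th w).
Proof.
rewrite /lin; under eq_bigr do rewrite extends_expand mulr_sumr.
rewrite exchange_big /=; apply: eq_bigr => u _.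
have -> : \sum_w th w * (word_coef (val u) (val w) * word_orth (val u) x) =
   word_orth (val u) x * \sum_w word_coef (val u) (val w) * th w.
  by rewrite mulr_sumr; apply: eq_bigr => w _; ring.
congr (_ * _); rewrite (bigD1 u) //= word_coef_diag mul1r; congr (_ + _).
rewrite big_mkcond [RHS]big_mkcond /=; apply: eq_bigr => w _.
case: (eqVneq w u) => [->|wu] /=; first by rewrite ltnn.
case: ltnP => // h; apply/eqP; rewrite mulf_eq0; apply/orP; left.
apply: contraLR h => h; rewrite -ltnNge; apply: word_coef_rank h _.
by rewrite eq_sym (inj_eq val_inj).
Qed.

(** Orthogonality of the basis; the change of coordinates is unitriangular for
word_rank. *)
Lemma lin_sqr (th : W -> R) :
  \sum_x lin extends th x ^+ 2 =
  \sum_(u : W) word_sqnorm (val u) *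
     (th u + \sum_(w : W | (word_rank (val w) < word_rank (val u))%N) word_coef (val u) (val w) * th w) ^+ 2.
Proof.
under eq_bigr do rewrite lin_expand.
pose y (u : W) := th u + \sum_(w : W | (word_rank (val w) < word_rank (val u))%N) word_coef (val u) (val w) * th w.
rewrite -/y.
transitivity (\sum_x \sum_(u : W) \sum_(v : W) (y u * y v) * (word_orth (val u) x * word_orth (val v) x)).
  apply: eq_bigr => x _; rewrite expr2 mulr_suml; apply: eq_bigr => u _.
  by rewrite mulr_sumr; apply: eq_bigr => v _; rewrite -/(y u) -/(y v); ring.
rewrite exchange_big /=; apply: eq_bigr => u _.
rewrite exchange_big /= (bigD1 u) //= [X in _ + X]big1 ?addr0.
  by rewrite -mulr_sumr word_orth_dot eqxx mul1r mulrC expr2.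
move=> v vu; rewrite -mulr_sumr word_orth_dot.
by rewrite (inj_eq val_inj) eq_sym (negbTE vu) mul0r mulr0.
Qed.

Lemma word_sqnorm_gt0 u : 0 < word_sqnorm u.
Proof. by apply: prodr_gt0 => i _; exact: letter_sqnorm_gt0. Qed.

Lemma card_word : #|{ffun 'I_n -> 'I_k.+1}| = (k.+1 ^ n)%N.
Proof. by rewrite card_ffun !card_ord. Qed.

Lemma word_sqnorm_le u : word_sqnorm u <= #|{ffun 'I_n -> 'I_k.+1}|%:R.
Proof.
rewrite card_word natrX -[n in _ ^+ n]card_ord -prodr_const.
by apply: ler_prod => i _; rewrite letter_sqnorm_le ltW // letter_sqnorm_gt0.
Qed.
End Words.

(** * Counting words by their support *)

Section Cards.
Context {R : realType}.
Variables n k t : nat.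
Local Notation letter := 'I_k.+1.
Local Notation word := {ffun 'I_n -> 'I_k.+1}.
Local Notation W := {w : word | w \in low_weight n k t}.

Lemma card_supp (S : {set 'I_n}) : #|[set w : word | supp w == S]| = (k ^ #|S|)%N.
Proof.
have -> : #|[set w : word | supp w == S]| =
   #|family (fun i => if i \in S then predC1 (ord0 : letter) else pred1 ord0)|.
  apply: eq_card => w; rewrite inE.
  apply/eqP/familyP => [<- i|h].
    by rewrite inE; case: ifP => wi; rewrite inE // (negbFE wi).
  apply/setP => i; rewrite inE; have := h i; case: ifP => _; rewrite inE => wi; first exact: wi.
  by rewrite (eqP wi) eqxx.
rewrite card_family foldrE big_map big_enum /=.
rewrite (eq_bigr (fun i => if i \in S then k else 1%N)); last first.
  by move=> i _; case: ifP => _; rewrite ?cardC1 ?card_ord ?card1.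
by rewrite -big_mkcond /= prod_nat_const.
Qed.

Lemma card_supp_pred (P : pred {set 'I_n}) :
  #|[set w : word | P (supp w)]| = (\sum_(S | P S) k ^ #|S|)%N.
Proof.
rewrite -sum1_card (partition_big (@supp n k) P) /=; last by move=> w; rewrite inE.
apply: eq_bigr => S PS; rewrite -card_supp -sum1_card; apply: eq_bigl => w.
by rewrite !inE; case: eqP => [->|]; rewrite ?PS ?andbF.
Qed.

Lemma card_low_weight : #|{: W}| = (\sum_(0 <= i < t.+1) 'C(n, i) * k ^ i)%N.
Proof.
rewrite card_sig; transitivity #|[set w : word | (fun S : {set 'I_n} => #|S| <= t)%N (supp w)]|.
  by apply: eq_card => w; rewrite !inE.
rewrite (card_supp_pred (fun S => (#|S| <= t)%N)) big_mkord.
rewrite (partition_big (fun S : {set 'I_n} => inord #|S| : 'I_t.+1) xpredT) //=.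
apply: eq_bigr => i _.
rewrite (eq_bigr (fun=> k ^ i)%N) => [|S /andP[St /eqP <-]]; last by rewrite inordK.
rewrite sum_nat_const; congr (_ * _)%N.
rewrite -[in 'C(n, i)](card_ord n) -cardsT -cards_draws -cardsE; apply: eq_card => S.
rewrite !inE finset.subsetT unfold_in /= -(inj_eq val_inj) /=.
case: leqP => St /=; first by rewrite inordK.
by case: eqP => // Si; rewrite Si ltnNge leq_ord in St.
Qed.

Lemma supp_upw (u : word) i a :
  supp (upd u i a) = if a == ord0 then supp u :\ i else i |: supp u.
Proof.
apply/setP => j; rewrite !inE ffunE.
case: (eqVneq a ord0) => a0; rewrite !inE; case: (eqVneq j i) => ji //=.
by rewrite a0.
Qed.

(** Take the factors of one position i and group the words that agree
elsewhere. If fewer than t other letters are nonzero the letter at i is free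
and the product over it is 1; if exactly t are nonzero it must be 0 and
contributes k + 1. *)
Lemma prod_word_sqnorm : \prod_(u : W) word_sqnorm (val u) = (k.+1%:R : R) ^+ (n * 'C(n - 1, t) * k ^ t).
Proof.
rewrite -(big_sub (low_weight n k t) (fun u => word_sqnorm u)) /word_sqnorm exchange_big /=.
rewrite (eq_bigr (fun=> (k.+1%:R : R) ^+ ('C(n - 1, t) * k ^ t))) => [|i _].
  by rewrite prodr_const card_ord -exprM mulnC mulnA.
rewrite (partition_big (fun u : word => upd u i ord0)
   (fun z : word => (#|supp z| <= t)%N && (i \notin supp z))) /=; last first.
  move=> u; rewrite inE supp_upw eqxx !inE eqxx /= andbT => h.
  exact: leq_trans (subset_leq_card (subsetDl _ _)) h.
transitivity (\prod_(z : word | (#|supp z| <= t)%N && (i \notin supp z))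
    (if #|supp z| == t then (k.+1%:R : R) else 1)).
  apply: eq_bigr => z /andP[zt iz].
  rewrite (reindex_onto (fun a => upd z i a) (fun u : word => u i)) /=; last first.
    move=> u /andP[_ /eqP <-]; apply/ffunP => j; rewrite !ffunE.
    by case: eqP => [->|].
  have zi : z i = ord0 by move: iz; rewrite inE negbK => /eqP.
  transitivity (\prod_(a : letter | (a == ord0) || (#|supp z| < t)%N) (letter_sqnorm a : R)).
    apply: eq_big => [a|a _]; last by rewrite ffunE eqxx.
    rewrite inE supp_upw ffunE eqxx eqxx andbT.
    have -> : upd (upd z i a) i ord0 = z.
      by apply/ffunP => j; rewrite !ffunE; case: eqP => // ->.
    rewrite eqxx andbT; case: (eqVneq a ord0) => _ /=.
      by rewrite (leq_trans (subset_leq_card (subsetDl _ _)) zt).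
    by rewrite cardsU1 iz.
  case: ltngtP zt => // [zlt|ze] _.
    under eq_bigl do rewrite orbT.
    exact: prod_letter_sqnorm.
  under eq_bigl do rewrite orbF.
  by rewrite big_pred1_eq /letter_sqnorm eqxx.
rewrite -big_mkcondr prodr_const; congr (_ ^+ _).
transitivity #|[set w : word | (fun S : {set 'I_n} => (#|S| == t) && (i \notin S)) (supp w)]|.
  rewrite cardsE; apply: eq_card => z; rewrite !unfold_in /=.
  by case: (ltngtP #|supp z| t); rewrite ?andbF ?andbT.
rewrite (card_supp_pred (fun S => (#|S| == t) && (i \notin S))).
rewrite (eq_bigr (fun=> k ^ t)%N); last by move=> S /andP[/eqP -> _].
rewrite sum_nat_const; congr (_ * _)%N.
have <- : #|[set~ i]| = (n - 1)%N by rewrite cardsC1 card_ord subn1.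
rewrite -cards_draws -cardsE; apply: eq_card => S; rewrite !inE andbC; congr (_ && _).
by rewrite finset.subsetC finset.sub1set inE.
Qed.
End Cards.

(** * Values of a low degree function from random values *)

Section Decode.
Context {R : realType}.
Variables n k t : nat.
Local Notation letter := 'I_k.+1.
Local Notation word := {ffun 'I_n -> 'I_k.+1}.
Local Notation W := {w : word | w \in low_weight n k t}.

Lemma prod_sub_expand (a b : 'I_n -> R) (J : {set 'I_n}) :
  \prod_i (if i \in J then a i - b i else b i) =
  \sum_(K : {set 'I_n} | K \subset J) (-1) ^+ #|J :\: K| * \prod_i (if i \in K then a i else b i).
Proof.
transitivity (\prod_i ((if i \in J then a i else 0) + (if i \in J then - b i else b i))).
  by apply: eq_bigr => i _; case: ifP; rewrite ?add0r.
rewrite bigA_distr [RHS]big_mkcond /=; apply: eq_bigr => K _.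
case: ifP => [/fintype.subsetP KJ|/negbT/fintype.subsetPn [i iK iJ]]; last first.
  by rewrite (bigD1 i) //= iK (negbTE iJ) mul0r.
rewrite -prodr_const [X in _ = X * _]big_mkcond -big_split /=; apply: eq_bigr => i _.
rewrite !inE; case: ifP => iK /=; first by rewrite (KJ _ iK) mul1r.
by case: ifP; rewrite ?mul1r ?mulN1r.
Qed.

(** The word x on K and y elsewhere. For uniformly random y it is uniform among
the words that agree with x on K, hence nearly uniform when K is small. *)
Definition splice (y x : word) (K : {set 'I_n}) : word := [ffun i => if i \in K then x i else y i].

Lemma prod_letter_test_splice (w y x : word) (K : {set 'I_n}) :
  \prod_i (if i \in K then letter_test (w i) (x i) else letter_test (w i) (y i)) =
  \prod_i letter_test (w i) (splice y x K i) :> R.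
Proof. by apply: eq_bigr => i _; rewrite ffunE; case: ifP. Qed.

(** Write each factor of f_w at x as its value at y plus the difference and
expand. The difference vanishes outside the support of w, so only sets J with
at most t elements occur. *)
Lemma extends_decode (w : W) (x y : word) :
  (extends w x)%:R = \sum_(J : {set 'I_n} | (#|J| <= t)%N)
    \sum_(K : {set 'I_n} | K \subset J) (-1) ^+ #|J :\: K| * (extends w (splice y x K))%:R :> R.
Proof.
rewrite extendsE.
transitivity (\prod_i ((letter_test (val w i) (x i) - letter_test (val w i) (y i)) + letter_test (val w i) (y i)) : R).
  by apply: eq_bigr => i _; rewrite subrK.
rewrite bigA_distr [RHS]big_mkcond /=; apply: eq_bigr => J _.
case: leqP => Jt.
  rewrite prod_sub_expand; apply: eq_bigr => K _; by rewrite extendsE prod_letter_test_splice.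
have [i iJ iw] : exists2 i, i \in J & i \notin supp (val w).
  apply/fintype.subsetPn; apply: contraL Jt => /subset_leq_card h.
  by rewrite -leqNgt (leq_trans h) // low_weight_le.
rewrite (bigD1 i) //= iJ; move: iw; rewrite inE negbK => /eqP ->.
by rewrite /letter_test eqxx subrr mul0r.
Qed.

Lemma lin_decode (th : W -> R) (x y : word) :
  lin (@extends n k t) th x = \sum_(J : {set 'I_n} | (#|J| <= t)%N)
    \sum_(K : {set 'I_n} | K \subset J) (-1) ^+ #|J :\: K| * lin (@extends n k t) th (splice y x K).
Proof.
rewrite {1}/lin; under eq_bigr do rewrite (extends_decode _ x y) mulr_sumr.
rewrite exchange_big /=; apply: eq_bigr => J _.
under eq_bigr do rewrite mulr_sumr.
rewrite exchange_big /=; apply: eq_bigr => K _.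
by rewrite /lin mulr_sumr; apply: eq_bigr => w _; rewrite mulrCA.
Qed.

(** Inclusion-exclusion over the subwords of w. *)
Lemma extends_moebius (u w : W) :
  \sum_(K : {set 'I_n} | K \subset supp (val w)) (-1) ^+ #|supp (val w) :\: K| *
     (extends u (splice [ffun=> ord0] (val w) K))%:R = (u == w)%:R :> R.
Proof.
under eq_bigr do rewrite extendsE -prod_letter_test_splice.
rewrite -prod_sub_expand.
have h i : (if i \in supp (val w) then letter_test (val u i) (val w i) - letter_test (val u i) ([ffun=> ord0] i)
     else letter_test (val u i) ([ffun=> ord0] i)) = (val u i == val w i)%:R :> R.
  rewrite inE ffunE /letter_test; case: (eqVneq (val w i) ord0) => [->|wi] /=.
    by rewrite eq_sym orbb eq_sym.
  case: (eqVneq (val u i) ord0) => [ui|ui] /=; first by rewrite subrr ui eq_sym (negbTE wi).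
  by rewrite subr0 eq_sym.
under eq_bigr do rewrite h.
case: (eqVneq u w) => [->|uw]; first by rewrite big1 // => i _; rewrite eqxx.
have [i uvi] : exists i, val u i != val w i.
  apply/existsP; apply: contraR uw => /existsPn h'.
  by apply/eqP/val_inj/ffunP => i; have := h' i; rewrite negbK => /eqP.
by rewrite (bigD1 i) //= (negbTE uvi) mul0r.
Qed.

Lemma lin_moebius (th : W -> R) (w : W) :
  th w = \sum_(K : {set 'I_n} | K \subset supp (val w)) (-1) ^+ #|supp (val w) :\: K| *
     lin (@extends n k t) th (splice [ffun=> ord0] (val w) K).
Proof.
transitivity (\sum_u th u * (u == w)%:R).
  rewrite (bigD1 w) //= eqxx mulr1 big1 ?addr0 // => u /negbTE ->.
  by rewrite mulr0.
under [RHS]eq_bigr do rewrite /lin mulr_sumr.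
rewrite [RHS]exchange_big /=; apply: eq_bigr => u _.
by rewrite -extends_moebius mulr_sumr; apply: eq_bigr => K _; rewrite mulrCA.
Qed.

(** At most (k + 1) ^ #|K| words y give the same spliced word. *)
Lemma sum_splice (g : word -> R) (x : word) (K : {set 'I_n}) : (forall z, 0 <= g z) -> (#|K| <= t)%N ->
  \sum_y g (splice y x K) <= k.+1%:R ^+ t * \sum_z g z.
Proof.
move=> g0 Kt.
rewrite (partition_big (fun y => splice y x K) xpredT) //= mulr_sumr; apply: ler_sum => z _.
rewrite (eq_bigr (fun=> g z)) => [|y /eqP -> //].
rewrite sumr_const -[leLHS]mulr_natl ler_wpM2r // -natrX ler_nat.
apply: leq_trans (_ : k.+1 ^ #|K| <= _)%N; last exact: leq_pexp2l.
have <- : #|family (fun i => if i \in K then predT : pred letter else pred1 (z i))| = (k.+1 ^ #|K|)%N.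
  rewrite card_family foldrE big_map big_enum /=.
  rewrite (eq_bigr (fun i => if i \in K then k.+1 else 1%N)); last first.
    by move=> i _; case: ifP => _; rewrite ?card_ord ?card1.
  by rewrite -big_mkcond /= prod_nat_const.
apply: subset_leq_card; apply/fintype.subsetP => y yP; have /eqP yz : splice y x K == z := yP.
apply/familyP => i; case: ifP => iK; rewrite inE //.
by rewrite -yz ffunE iK.
Qed.

Section Norm.
Variable N : R -> R.
Hypothesis ND : forall a b, N (a + b) <= N a + N b.
Hypothesis NN : forall a, N (- a) = N a.
Hypothesis N0 : N 0 = 0.
Hypothesis Nge0 : forall a, 0 <= N a.

Lemma seminorm_sum (I : Type) (s : seq I) (P : pred I) (F : I -> R) :
  N (\sum_(i <- s | P i) F i) <= \sum_(i <- s | P i) N (F i).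
Proof.
elim/big_rec2: _ => [|i x y _ h]; first by rewrite N0.
by apply: (le_trans (ND _ _)); rewrite lerD2l.
Qed.

Lemma seminorm_sign m a : N ((-1) ^+ m * a) = N a.
Proof. by rewrite -signr_odd; case: odd; rewrite ?expr1 ?mulN1r ?NN ?expr0 ?mul1r. Qed.

Lemma card_subsets (J : {set 'I_n}) : #|[set K : {set 'I_n} | K \subset J]| = (2 ^ #|J|)%N.
Proof. by rewrite -card_powerset; apply: eq_card => K; rewrite !inE. Qed.

Lemma card_small_sets : (0 < k)%N -> (#|[set J : {set 'I_n} | (#|J| <= t)%N]| <= #|{: W}|)%N.
Proof.
move=> k0; rewrite card_sig.
apply: leq_trans (_ : #|[set w : word | (fun S : {set 'I_n} => #|S| <= t)%N (supp w)]| <= _)%N; last first.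
  by rewrite subset_leq_card //; apply/fintype.subsetP => w; rewrite !inE.
rewrite (card_supp_pred _ (fun S : {set 'I_n} => (#|S| <= t)%N)) -sum1_card.
rewrite (eq_bigl (fun S : {set 'I_n} => (#|S| <= t)%N)); last by move=> S; rewrite inE.
by apply: leq_sum => S _; rewrite expn_gt0 k0.
Qed.

(** Average lin_decode over y. The number of sets J is at most the number of
low weight words, each J has at most 2 ^ t subsets, and sum_splice costs
(k + 1) ^ t. *)
Lemma seminorm_lin (th : W -> R) (x : word) : (0 < k)%N ->
  #|{ffun 'I_n -> 'I_k.+1}|%:R * N (lin (@extends n k t) th x) <=
   (#|{: W}|%:R * 2 ^+ t * k.+1%:R ^+ t) * \sum_z N (lin (@extends n k t) th z).
Proof.
move=> k0; set S := \sum_z _.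
have S0 : 0 <= S by apply: sumr_ge0.
have -> : #|{ffun 'I_n -> 'I_k.+1}|%:R * N (lin (@extends n k t) th x) = \sum_(y : word) N (lin (@extends n k t) th x).
  by rewrite sumr_const mulr_natl.
apply: (@le_trans _ _ (\sum_(y : word) \sum_(J : {set 'I_n} | (#|J| <= t)%N)
    \sum_(K : {set 'I_n} | K \subset J) N (lin (@extends n k t) th (splice y x K)))).
  apply: ler_sum => y _; rewrite (lin_decode th x y).
  apply: (le_trans (seminorm_sum _ _ _)); apply: ler_sum => J _.
  apply: (le_trans (seminorm_sum _ _ _)); apply: ler_sum => K _.
  by rewrite seminorm_sign.
rewrite exchange_big /=.
apply: (@le_trans _ _ (\sum_(J : {set 'I_n} | (#|J| <= t)%N) 2 ^+ t * (k.+1%:R ^+ t * S))).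
  apply: ler_sum => J Jt; rewrite exchange_big /=.
  apply: (@le_trans _ _ (\sum_(K : {set 'I_n} | K \subset J) k.+1%:R ^+ t * S)).
    apply: ler_sum => K KJ; apply: (sum_splice x (fun z => Nge0 (lin (@extends n k t) th z))).
    exact: leq_trans (subset_leq_card KJ) Jt.
  rewrite sumr_const -[leLHS]mulr_natl ler_wpM2r ?mulr_ge0 ?exprn_ge0 //.
  rewrite -cardsE card_subsets -natrX ler_nat leq_exp2l //.
rewrite sumr_const -[leLHS]mulr_natl !mulrA ler_wpM2r // ler_wpM2r ?exprn_ge0 // ler_wpM2r ?exprn_ge0 //.
by rewrite ler_nat -cardsE card_small_sets.
Qed.

(** A coefficient is a signed sum of at most 2 ^ t values by lin_moebius. *)
Lemma seminorm_coef (th : W -> R) (w : W) : (0 < k)%N ->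
  #|{ffun 'I_n -> 'I_k.+1}|%:R * N (th w) <=
   (#|{: W}|%:R * 4 ^+ t * k.+1%:R ^+ t) * \sum_z N (lin (@extends n k t) th z).
Proof.
move=> k0; set S := \sum_z _.
have S0 : 0 <= S by apply: sumr_ge0.
rewrite (lin_moebius th w).
apply: (le_trans (ler_wpM2l _ (seminorm_sum _ _ _))) => //.
under eq_bigr do rewrite seminorm_sign.
rewrite mulr_sumr.
apply: (@le_trans _ _ (\sum_(K : {set 'I_n} | K \subset supp (val w))
   (#|{: W}|%:R * 2 ^+ t * k.+1%:R ^+ t) * S)).
  by apply: ler_sum => K _; exact: seminorm_lin.
rewrite sumr_const -[leLHS]mulr_natl !mulrA ler_wpM2r // ler_wpM2r ?exprn_ge0 //.
rewrite -cardsE card_subsets.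
have -> : (4 : R) ^+ t = 2 ^+ t * 2 ^+ t by rewrite -exprMn -natrM.
rewrite mulrA ler_wpM2r ?exprn_ge0 // mulrC ler_wpM2l ?ler0n //.
by rewrite -natrX ler_nat leq_exp2l // low_weight_le.
Qed.
End Norm.
End Decode.

(** * Orthogonal arrays as sets with prescribed counts *)

Section OA.
Variables n k t : nat.
Local Notation letter := 'I_k.+1.
Local Notation word := {ffun 'I_n -> 'I_k.+1}.
Local Notation W := {w : word | w \in low_weight n k t}.

Definition agree_count (T : {set word}) (S : {set 'I_n}) (v : word) : nat :=
  #|[set x in T | agree S v x]|.

Lemma agree_upd (S : {set 'I_n}) (v x : word) (i : 'I_n) a : i \notin S ->
  agree (i |: S) (upd v i a) x = (x i == a) && agree S v x.
Proof.
move=> iS; apply/forall_inP/andP => [h|[/eqP xi /forall_inP h] j].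
  split; first by have := h i; rewrite !inE eqxx ffunE eqxx => /(_ isT).
  apply/forall_inP => j jS; have := h j; rewrite !inE jS orbT ffunE => /(_ isT).
  by case: (eqVneq j i) => // ji; rewrite -ji jS in iS.
rewrite !inE ffunE; case: (eqVneq j i) => [-> _|_ /= jS]; first by rewrite xi.
exact: h.
Qed.

(** Sort the words by their letter at i. *)
Lemma agree_count_split (T : {set word}) (S : {set 'I_n}) (v : word) (i : 'I_n) : i \notin S ->
  agree_count T S v = (\sum_a agree_count T (i |: S) (upd v i a))%N.
Proof.
move=> iS; rewrite /agree_count -sum1_card (partition_big (fun x : word => x i) xpredT) //=.
apply: eq_bigr => a _; rewrite -sum1_card; apply: eq_bigl => x.
by rewrite !inE agree_upd // -andbA [agree S v x && _]andbC.
Qed.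

Lemma agree_congr (S : {set 'I_n}) (v v' x : word) : (forall i, i \in S -> v i = v' i) ->
  agree S v x = agree S v' x.
Proof.
move=> h; apply/forall_inP/forall_inP => g i iS; first by rewrite -h // g.
by rewrite h // g.
Qed.

Lemma agree_count_congr (T : {set word}) (S : {set 'I_n}) (v v' : word) : (forall i, i \in S -> v i = v' i) -> agree_count T S v = agree_count T S v'.
Proof.
by move=> h; rewrite /agree_count; apply: eq_card => x; rewrite !inE (agree_congr _ h).
Qed.

Lemma hitE T (E : W -> nat) : hit (@extends n k t) E T =
   [forall w : W, agree_count T (supp (val w)) (val w) == E w].
Proof.
apply: eq_forallb => w; congr (_ == _).
rewrite /agree_count /extends -sum1_card big_mkcond [RHS]big_mkcond /=.
by apply: eq_bigr => x _; rewrite !inE; case: (x \in T) => //=; case: agree.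
Qed.

Variable M : nat.

(** Induction on the number of zero letters prescribed by v on S: the count
with a prescribed 0 is the count without that constraint minus the counts with
the other letters. *)
Lemma agree_count_all_of_low (T : {set word}) :
  (forall w : W, agree_count T (supp (val w)) (val w) = M * k.+1 ^ (t - #|supp (val w)|))%N ->
  forall (S : {set 'I_n}) (v : word), (#|S| <= t)%N -> agree_count T S v = (M * k.+1 ^ (t - #|S|))%N.
Proof.
move=> h S v.
have [m hm] := ubnP #|[set i in S | v i == ord0]|.
elim: m S v hm => // m IH S v hm St.
have [/forall_inP h0|] := boolP [forall i in S, v i != ord0].
  pose w0 : word := [ffun i => if i \in S then v i else ord0].
  have sw : supp w0 = S.
    apply/setP => i; rewrite inE ffunE; case: ifP => iS; first by rewrite h0.
    by rewrite eqxx.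
  have w0l : w0 \in low_weight n k t by rewrite inE sw.
  have := h (Sub w0 w0l); rewrite SubK sw => <-.
  by apply: agree_count_congr => i iS; rewrite ffunE iS.
rewrite negb_forall_in => /exists_inP [i iS]; rewrite negbK => /eqP vi.
have iS' : i \notin S :\ i by rewrite !inE eqxx.
have := agree_count_split T v iS'; rewrite finset.setD1K // (bigD1 ord0) //=.
have -> : upd v i ord0 = v.
  by apply/ffunP => j; rewrite ffunE; case: eqP => // ->.
have cS : #|S| = #|S :\ i|.+1 by rewrite (cardsD1 i) iS.
have sub : [set j in S :\ i | v j == ord0] = [set j in S | v j == ord0] :\ i.
  by apply/setP => j; rewrite !inE andbA.
have card0 : #|[set j in S | v j == ord0]| = #|[set j in S :\ i | v j == ord0]|.+1.
  by rewrite sub (cardsD1 i [set j in S | _]) !inE iS vi eqxx.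
have hlt : (#|[set j in S :\ i | v j == ord0]| < m)%N by rewrite -ltnS -card0.
rewrite IH //; last by rewrite -ltnS -cS ltnW.
rewrite (eq_bigr (fun=> M * k.+1 ^ (t - #|S|))%N) => [|a a0]; last first.
  rewrite IH //; apply: leq_ltn_trans hlt; apply: subset_leq_card; apply/fintype.subsetP => j.
  rewrite !inE ffunE; case: (eqVneq j i) => [_|_] //=.
  by rewrite (negbTE a0) andbF.
rewrite sum_nat_const cardC1 card_ord.
have -> : (t - #|S :\ i| = (t - #|S|).+1)%N by rewrite cS subnSK // -cS.
rewrite expnS; move: (k.+1 ^ _)%N (agree_count T S v) => X Y /eqP e.
have : (k * (M * X) + M * X = k * (M * X) + Y)%N.
  by apply/eqP; rewrite [X in _ == X]addnC -(eqP e); apply/eqP; ring.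
by move/eqP; rewrite eqn_add2l => /eqP.
Qed.

(** Downwards induction on the number of constraints, by agree_count_split. *)
Lemma agree_count_all_of_top (T : {set word}) : (t <= n)%N ->
  (forall (S : {set 'I_n}) (v : word), #|S| = t -> agree_count T S v = M) ->
  forall (S : {set 'I_n}) (v : word), (#|S| <= t)%N -> agree_count T S v = (M * k.+1 ^ (t - #|S|))%N.
Proof.
move=> tn h S v St.
have [m hm] : exists m, m = (t - #|S|)%N by exists (t - #|S|)%N.
elim: m S v St hm => [|m IH] S v St hm.
  by rewrite -hm expn0 muln1 h //; apply/eqP; rewrite eqn_leq St -subn_eq0 -hm.
have /existsP [i iS] : [exists i, i \notin S].
  apply: contraTT St => /existsPn hS; rewrite -ltnNge.
  have -> : S = finset.setT by apply/setP => i; rewrite inE; have := hS i; rewrite negbK.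
  rewrite cardsT card_ord; move: hm.
  have -> : S = finset.setT by apply/setP => i; rewrite inE; have := hS i; rewrite negbK.
  by rewrite cardsT card_ord => /esym/eqP; lia.
rewrite (agree_count_split T v iS).
have cS : #|i |: S| = #|S|.+1 by rewrite cardsU1 iS.
rewrite (eq_bigr (fun=> M * k.+1 ^ m)%N) => [|a _].
  by rewrite sum_nat_const card_ord -hm expnS mulnCA.
have hm' : m = (t - #|i |: S|)%N by rewrite cS; lia.
by rewrite (IH _ _ _ hm') -?hm' // cS; lia.
Qed.

Lemma agree_count_set0 (T : {set word}) (v : word) : agree_count T finset.set0 v = #|T|.
Proof.
apply: eq_card => x; rewrite inE; case: (x \in T) => //=.
by apply/forall_inP => i; rewrite inE.
Qed.

Lemma hit_orthogonal_array (T : {set word}) : (t <= n)%N ->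
  hit (@extends n k t) (fun w => M * k.+1 ^ (t - #|supp (val w)|))%N T =
  orthogonal_array t T && (#|T| == M * k.+1 ^ t)%N.
Proof.
move=> tn; rewrite hitE; apply/forallP/andP => [h|[oa /eqP hT]].
  have {}h := agree_count_all_of_low (fun w => eqP (h w)).
  have cT : #|T| = (M * k.+1 ^ t)%N.
    by have := h finset.set0 [ffun=> ord0] _; rewrite agree_count_set0 cards0 subn0 => ->.
  split; last by rewrite cT.
  apply/forallP => i; apply/implyP => /injectiveP ii; apply/forallP => v.
  pose w : word := [ffun x => if [pick j | i j == x] is Some j then v j else ord0].
  have wi j : w (i j) = v j.
    rewrite ffunE; case: pickP => [j' /eqP /ii -> //|/(_ j)].
    by rewrite eqxx.
  have cI : #|[set i j | j : 'I_t]| = t by rewrite card_imset // card_ord.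
  have -> : #|[set x in T | [forall j, x (i j) == v j]]| = agree_count T [set i j | j : 'I_t] w.
    apply: eq_card => x; rewrite !inE; congr (_ && _).
    apply/forallP/forall_inP => [g _ /imsetP [j _ ->]|g j]; first by rewrite wi.
    by rewrite -wi g // imset_f.
  rewrite h cI // subnn expn0 muln1 cT natrM natrX.
  by rewrite mulrC mulfK // expf_neq0 // pnatr_eq0.
move=> w; apply/eqP; apply: agree_count_all_of_top => //; last exact: low_weight_le.
move=> S v St.
have [i [ii iS]] : exists i : {ffun 'I_t -> 'I_n}, injective i /\ [set i j | j : 'I_t] = S.
  pose i0 (j : 'I_t) : 'I_n := enum_val (cast_ord (esym St) j).
  exists [ffun j => i0 j]; split.
    by move=> j j'; rewrite !ffunE => /enum_val_inj /cast_ord_inj.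
  apply/eqP; rewrite eqEcard card_imset ?card_ord ?St ?leqnn ?andbT; last first.
    by move=> j j'; rewrite !ffunE => /enum_val_inj /cast_ord_inj.
  by apply/fintype.subsetP => _ /imsetP [j _ ->]; rewrite ffunE enum_valP.
have /forallP /(_ i) /implyP /(_ (introT (injectiveP _) ii)) /forallP /(_ [ffun j => v (i j)]) := oa.
have -> : #|[set x in T | [forall j, x (i j) == [ffun j0 => v (i j0)] j]]| = agree_count T S v.
  apply: eq_card => x; rewrite !inE; congr (_ && _); rewrite -iS.
  apply/forallP/forall_inP => [g _ /imsetP [j _ ->]|g j].
    by have := g j; rewrite ffunE.
  by rewrite ffunE g // imset_f.
rewrite hT natrM natrX [_%:R * _]mulrC mulKf ?expf_neq0 ?pnatr_eq0 //.
by rewrite eqr_nat => /eqP.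
Qed.

End OA.

(** * Size of the error terms *)

Section Bounds.
Context {R : realType}.

(** Chernoff's argument: with z = t / ((k + 1) n) <= 1 the sum times z ^ t is
at most (1 + k z) ^ n <= exp t. *)
Lemma sum_bin_le (k n t : nat) : (0 < t <= n)%N ->
  ((\sum_(0 <= i < t.+1) 'C(n, i) * k ^ i)%N%:R : R) <= (expR 1 * (k.+1%:R * n%:R / t%:R)) ^+ t.
Proof.
move=> /andP[t0 tn].
have n0 : (0 < n)%N by apply: leq_trans tn.
have tR : 0 < (t%:R : R) by rewrite ltr0n.
have nR : 0 < (n%:R : R) by rewrite ltr0n.
have kR : 0 < (k.+1%:R : R) by rewrite ltr0n.
set z : R := t%:R / (k.+1%:R * n%:R).
have z0 : 0 < z by rewrite divr_gt0 // mulr_gt0.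
have z1 : z <= 1.
  rewrite ler_pdivrMr ?mulr_gt0 // mul1r -natrM ler_nat (leq_trans tn) //.
  by rewrite leq_pmull.
have -> : k.+1%:R * n%:R / t%:R = z^-1 by rewrite /z invf_div.
rewrite exprMn exprVn ler_pdivlMr ?exprn_gt0 //.
rewrite -expRM_natl mulr1.
apply: (@le_trans _ _ ((1 + k%:R * z) ^+ n)).
  rewrite exprDn natr_sum big_mkord mulr_suml.
  rewrite -(big_mkord xpredT (fun i => 1 ^+ (n - i) * (k%:R * z) ^+ i *+ 'C(n, i))).
  rewrite (big_cat_nat (leq0n t.+1) (_ : t.+1 <= n.+1)%N) //= big_mkord.
  apply: ler_wpDr.
    by apply: sumr_ge0 => i _; rewrite mulrn_wge0 // mulr_ge0 ?exprn_ge0 ?expr1n // mulr_ge0 // ltW.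
  apply: ler_sum => i _; rewrite expr1n mul1r -[leRHS]mulr_natl natrM natrX [(k%:R * z) ^+ i]exprMn [leRHS]mulrA.
  by rewrite ler_wpM2l ?mulr_ge0 ?exprn_ge0 // ler_wiXn2l ?(ltW z0) // -ltnS.
have h : 1 + k%:R * z <= expR (k%:R * z) by exact: expR_ge1Dx.
apply: (@le_trans _ _ (expR (k%:R * z) ^+ n)).
  by rewrite lerXn2r // nnegrE ?expR_ge0 // addr_ge0 // mulr_ge0 // ltW.
rewrite -expRM_natl ler_expR /z.
have -> : n%:R * (k%:R * (t%:R / (k.+1%:R * n%:R))) = k%:R / k.+1%:R * t%:R :> R.
  by field; rewrite nat1r pnatr_eq0 lt0r_neq0.
by rewrite ler_piMl ?(ltW tR) // ler_pdivrMr // mul1r ler_nat.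
Qed.

(** Any large constant would do; this one dominates the powers of 2 and of e
met in threshold_bound. *)
Definition threshold : R := 2 ^+ 34 * expR 1 ^+ 14.

Lemma threshold_ge : 18 <= threshold.
Proof.
have e1 : 1 <= expR 1 :> R by have := expR_ge1Dx (1 : R); lra.
have : 1 <= expR 1 ^+ 14 :> R by exact: exprn_ege1.
have -> : threshold = 2 ^+ 29 * (32 * expR 1 ^+ 14) by rewrite /threshold; ring.
have : 1 <= 2 ^+ 29 :> R by apply: exprn_ege1; lra.
move: (expR 1 ^+ 14) (2 ^+ 29) => X Z; nra.
Qed.

(** The left side is 200 Y ^ 2 for the error Y of local_limit with
A = r 4 ^ t qt. Once r and qt are bounded all factors are t-th powers, of total
degree 18 in s. *)
Lemma threshold_bound (r qt s : R) (t : nat) : (0 < t)%N -> 1 <= s -> 1 <= r ->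
  r <= (expR 1 * s) ^+ t -> 0 <= qt <= s ^+ t ->
  200 * (512 * (r * 4 ^+ t * qt) ^+ 2 * r ^+ 5) ^+ 2 <= (threshold * s) `^ (threshold * t%:R).
Proof.
move=> t0 s1 r1 hr /andP[q0 hq].
have e1 : 1 <= expR 1 :> R by have := expR_ge1Dx (1 : R); lra.
have c18 := threshold_ge.
have cs1 : 1 <= threshold * s by nra.
apply: (@le_trans _ _ ((threshold * s) ^+ (18 * t))); last first.
  rewrite -powR_mulrn; last by lra.
  by rewrite ler_powR // natrM ler_wpM2r ?ler0n.
have -> : 200 * (512 * (r * 4 ^+ t * qt) ^+ 2 * r ^+ 5) ^+ 2 =
   (200 * 512 ^+ 2) * ((4 ^+ t) ^+ 4 * r ^+ 14 * qt ^+ 4) by ring.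
apply: (@le_trans _ _ (2 ^+ 26 ^+ t * ((4 ^+ t) ^+ 4 * (expR 1 * s) ^+ t ^+ 14 * s ^+ t ^+ 4))).
  apply: ler_pM.
  - exact: mulr_ge0 (ler0n _ 200) (exprn_ge0 2 (ler0n _ 512)).
  - by rewrite !mulr_ge0 ?exprn_ge0 //; lra.
  - apply: (@le_trans _ _ (2 ^+ 26)); last by rewrite ler_eXnr // exprn_ege1; lra.
    have -> : 2 ^+ 26 = 256 * 512 ^+ 2 :> R by ring.
    have h : 0 <= 512 ^+ 2 :> R := exprn_ge0 2 (ler0n _ 512).
    by apply: (ler_wpM2r h); rewrite ler_nat.
  apply: ler_pM; [by rewrite mulr_ge0 ?exprn_ge0 //; lra | by rewrite exprn_ge0 | |].
    by rewrite ler_wpM2l ?exprn_ge0 // lerXn2r // ?nnegrE ?exprn_ge0 ?mulr_ge0 ?expR_ge0 //; lra.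
  by rewrite lerXn2r // nnegrE exprn_ge0 //; lra.
rewrite (exprM _ 18 t).
have -> : 2 ^+ 26 ^+ t * ((4 ^+ t) ^+ 4 * (expR 1 * s) ^+ t ^+ 14 * s ^+ t ^+ 4) =
  (2 ^+ 34 * expR 1 ^+ 14 * s ^+ 18) ^+ t :> R.
  have P (x : R) j : x ^+ t ^+ j = x ^+ j ^+ t by rewrite -!exprM mulnC.
  by rewrite !P -!(exprMn t); congr (_ ^+ t); ring.
rewrite lerXn2r // ?nnegrE ?exprn_ge0 ?mulr_ge0 ?exprn_ge0 ?expR_ge0 //; try lra.
rewrite -/threshold exprMn ler_wpM2r ?exprn_ge0 //; first by lra.
by rewrite ler_eXnr //; lra.
Qed.
End Bounds.

(** * The number of orthogonal arrays *)

Section Count.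
Context {R : realType}.
Variables n k t : nat.
Local Notation word := {ffun 'I_n -> 'I_k.+1}.
Local Notation W := {w : word | w \in low_weight n k t}.

(** A word that extends w is free exactly outside the support of w. *)
Lemma sum_extends (w : W) :
  \sum_x (extends w x)%:R = (k.+1%:R : R) ^+ (n - #|supp (val w)|).
Proof.
under eq_bigr do rewrite extendsE.
rewrite -(bigA_distr_bigA (fun i b => letter_test (val w i) b)) /=.
transitivity (\prod_(i in ~: supp (val w)) (k.+1%:R : R)).
  rewrite [RHS]big_mkcond /=; apply: eq_bigr => i _; rewrite !inE negbK /letter_test.
  case: (eqVneq (val w i) ord0) => wi /=.
    by rewrite sumr_const card_ord.
  by rewrite -natr_sum -big_mkcond /= (big_pred1 (val w i)).
by rewrite prodr_const cardsCs finset.setCK card_ord.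
Qed.

Lemma abs_sin_subadd (a b : R) :
  `|sin (pi * (a + b))| <= `|sin (pi * a)| + `|sin (pi * b)|.
Proof.
rewrite mulrDr sinD; apply: (le_trans (ler_normD _ _)); rewrite !normrM.
by apply: lerD; [rewrite ler_piMr ?cos_max | rewrite ler_piMl ?cos_max].
Qed.

Lemma prod_sqrt (I : finType) (F : I -> R) : (forall i, 0 <= F i) ->
  \prod_i Num.sqrt (F i) = Num.sqrt (\prod_i F i).
Proof.
move=> F0; suff : 0 <= \prod_i F i /\ \prod_i Num.sqrt (F i) = Num.sqrt (\prod_i F i) by case.
elim/big_rec2: _ => [|i x y _ [y0 ->]]; first by rewrite sqrtr1.
by rewrite mulr_ge0 // sqrtrM.
Qed.

Lemma powR_half (x : R) (m : nat) : 0 <= x -> x `^ (1 / 2 * m%:R) = Num.sqrt x ^+ m.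
Proof.
by move=> x0; rewrite powRrM powR_mulrn ?powR_ge0 // mul1r powR12_sqrt.
Qed.

(** The square roots of the norms multiply to a power of k + 1 by
prod_word_sqnorm, and there are as many factors as low weight words. *)
Lemma gauss_mass_words (p : R) : 0 < p < 1 -> 
  gauss_mass p (fun u : W => word_sqnorm (val u)) =
  (k.+1%:R : R) `^ (- (1 / 2 * (n * 'C(n - 1, t) * (k.+1 - 1) ^ t)%N%:R))
   / (2 * pi * p * (1 - p)) `^ (1 / 2 * (\sum_(0 <= i < t.+1) 'C(n, i) * (k.+1 - 1) ^ i)%N%:R).
Proof.
move=> /andP[p0 p1]; have q0 : 0 < 1 - p by rewrite subr_gt0.
have pi0 := pi_gt0 R.
have v0 : 0 < 2 * pi * p * (1 - p) by rewrite !mulr_gt0.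
rewrite (subn1 k.+1) /= powRN !powR_half ?ler0n ?(ltW v0) // -card_low_weight /gauss_mass.
have e (u : W) : Num.sqrt (pi / gauss_coef p (fun u : W => word_sqnorm (val u)) u) =
   (Num.sqrt (2 * pi * p * (1 - p)))^-1 * (Num.sqrt (word_sqnorm (val u)))^-1.
  have d0 : 0 < (word_sqnorm (val u) : R) := word_sqnorm_gt0 _.
  rewrite -!sqrtrV ?(ltW d0) ?(ltW v0) // -sqrtrM ?invr_ge0 ?(ltW v0) //; congr Num.sqrt.
  rewrite /gauss_coef; move: (word_sqnorm _) d0 (pi : R) pi0 => d d0 pp pp0.
  by field; rewrite !lt0r_neq0.
under eq_bigr do rewrite e.
rewrite big_split /= prodr_const exprVn mulrC; congr (_ * _).
rewrite prodfV prod_sqrt => [|u]; last exact: ltW (word_sqnorm_gt0 _).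
rewrite prod_word_sqnorm; congr (_^-1).
have h : forall m, Num.sqrt ((k.+1%:R : R) ^+ m) = Num.sqrt (k.+1%:R) ^+ m.
  elim=> [|m IH]; first by rewrite !expr0 sqrtr1.
  by rewrite !exprS sqrtrM ?ler0n // IH.
exact: h.
Qed.

Lemma prob_hit_count (p : R) (M : nat) : (t <= n)%N ->
  prob_hit (@extends n k t) p (fun w => M * k.+1 ^ (t - #|supp (val w)|))%N =
  (num_orthogonal_arrays k.+1 n t (M * k.+1 ^ t))%:R *
   (p ^+ (M * k.+1 ^ t) * (1 - p) ^+ (k.+1 ^ n - M * k.+1 ^ t)).
Proof.
move=> tn; rewrite /prob_hit /num_orthogonal_arrays.
rewrite mulr_natl -sumr_const [RHS]big_mkcond /=.
apply: eq_bigr => T _; rewrite inE hit_orthogonal_array // card_word.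
case: orthogonal_array => /=; last by rewrite mulr0.
by case: eqP => [->|_]; rewrite ?mulr1 ?mulr0.
Qed.
End Count.

Theorem theorem1p2 (R : realType) :
  exists c : R, 0 < c /\
    forall q n t N : nat,
      (2 <= q)%N -> (1 <= n)%N -> (1 <= t <= n)%N ->
      (q ^ t %| N)%N ->
      (c * q%:R * n%:R / t%:R) `^ (c * t%:R)
        <= Num.min (N%:R : R) (q%:R ^+ n - N%:R) ->
      let p : R := N%:R / q%:R ^+ n in
      exists delta : R,
        (num_orthogonal_arrays q n t N)%:R =
          q%:R `^ (- (1 / 2 * (n * 'C(n - 1, t) * (q - 1) ^ t)%N%:R))
          / ((2 * pi * p * (1 - p))
               `^ (1 / 2 * (\sum_(0 <= i < t.+1) 'C(n, i) * (q - 1) ^ i)%N%:R)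
             * p ^+ N * (1 - p) ^+ (q ^ n - N))
          * (1 + delta) /\
        `|delta| <= (c * q%:R * n%:R / t%:R) `^ (c * t%:R)
                    / Num.sqrt (Num.min (N%:R : R) (q%:R ^+ n - N%:R)).
Proof.
have c18 := @threshold_ge R.
exists threshold; split; first by apply: lt_le_trans c18.
move=> q n t N q2 n1 /andP[t1 tn] /dvdnP [M NM] hX.
case: q q2 NM hX => // k k1 NM; rewrite {}NM => {N}.
set N := (M * k.+1 ^ t)%N; set X := _ `^ _; set mn := Num.min _ _ => hX p.
pose W := ({w : {ffun 'I_n -> 'I_k.+1} | w \in low_weight n k t}).
have tR : 0 < (t%:R : R) by rewrite ltr0n.
set s : R := k.+1%:R * n%:R / t%:R.
have Xs : X = (threshold * s) `^ (threshold * t%:R) by rewrite /X /s !mulrA.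
have s1 : k.+1%:R <= s.
  by rewrite /s -mulrA ler_peMr ?ler0n // ler_pdivlMr // mul1r ler_nat.
have s1' : 1 <= s by apply: le_trans s1; rewrite ler1n.
pose r : R := #|{: W}|%:R.
have W0 : (0 < #|{: W}|)%N.
  by rewrite card_low_weight big_nat_recl // expn0 muln1 bin0.
have r1 : 1 <= r by rewrite ler1n.
have hr : r <= (expR 1 * s) ^+ t by rewrite /r card_low_weight sum_bin_le // t1.
have hq : 0 <= (k.+1%:R : R) ^+ t <= s ^+ t.
  rewrite exprn_ge0 //= lerXn2r // nnegrE ?ler0n //; exact: le_trans s1'.
have := threshold_bound t1 s1' r1 hr hq; rewrite -Xs.
set A : R := r * 4 ^+ t * k.+1%:R ^+ t.
set Y : R := 512 * A ^+ 2 * r ^+ 5 => hY.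
have A1 : 1 <= A.
  have h4 : 1 <= 4 ^+ t :> R by apply: exprn_ege1; lra.
  have hk : 1 <= k.+1%:R ^+ t :> R by rewrite exprn_ege1 // ler1n.
  have h5 : 1 <= r * 4 ^+ t by rewrite mulr_ege1.
  by rewrite mulr_ege1.
have Y1 : 1 <= Y.
  have : 1 <= A ^+ 2 by exact: exprn_ege1.
  have : 1 <= r ^+ 5 by exact: exprn_ege1.
  rewrite /Y; move: (A ^+ 2) (r ^+ 5) => a b; nra.
set Q : R := k.+1%:R ^+ n.
have Q0 : 0 < Q by rewrite exprn_gt0 // ltr0n.
have X0 : 0 < X by apply: lt_le_trans hY; rewrite mulr_gt0 // exprn_gt0 //; lra.
have mn0 : 0 < mn by apply: lt_le_trans hX.
have [N0 NQ] : 0 < (N%:R : R) /\ (N%:R : R) < Q.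
  by move: mn0; rewrite /mn lt_min subr_gt0 => /andP[].
have p01 : 0 < p < 1 by rewrite /p divr_gt0 //= ltr_pdivrMr // mul1r.
have /andP[p0 p1] := p01; have q0 : 0 < 1 - p by rewrite subr_gt0.
have eQ : #|{ffun 'I_n -> 'I_k.+1}|%:R = Q by rewrite card_word natrX.
(* The larger of N and Q - N is at least Q / 2. *)
have s2mn : mn / 2 <= p * (1 - p) * Q.
  have -> : p * (1 - p) * Q = N%:R * (Q - N%:R) / Q.
    rewrite (_ : p = N%:R / Q) //.
    by move: (N%:R : R) (Q) Q0 => a b b0; field; rewrite lt0r_neq0.
  rewrite ler_pdivlMr // mulrAC ler_pdivrMr //.
  have : mn = N%:R /\ N%:R <= Q - N%:R \/ mn = Q - N%:R /\ Q - N%:R <= N%:R.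
    by rewrite /mn; case: leP => h; [left | right; split => //; exact: ltW].
  by case=> -[-> h]; nra.
have hs2 : Y ^+ 2 <= p * (1 - p) * #|{ffun 'I_n -> 'I_k.+1}|%:R.
  rewrite eQ; apply: le_trans s2mn.
  have : 1 <= Y ^+ 2 by exact: exprn_ege1.
  lra.
have hmax (N' : R -> R) (th : W -> R) x :
  (forall a b, N' (a + b) <= N' a + N' b) -> (forall a, N' (- a) = N' a) -> N' 0 = 0 ->
  (forall a, 0 <= N' a) ->
  #|{ffun 'I_n -> 'I_k.+1}|%:R * N' (lin (@extends n k t) th x) <= A * \sum_z N' (lin (@extends n k t) th z).
  move=> h1 h2 h3 h4; apply: (le_trans (seminorm_lin h1 h2 h3 h4 th x k1)).
  apply: ler_wpM2r; first exact: sumr_ge0.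
  rewrite /A ler_wpM2r ?exprn_ge0 // ler_wpM2l ?ler0n // lerXn2r ?nnegrE //; lra.
have h_sin (th : W -> R) w : #|{ffun 'I_n -> 'I_k.+1}|%:R * `|sin (pi * th w)| <=
    A * \sum_x `|sin (pi * lin (@extends n k t) th x)|.
  apply: (@seminorm_coef R n k t (fun z => `|sin (pi * z)|)) => //.
  - exact: abs_sin_subadd.
  - by move=> a; rewrite mulrN sinN normrN.
  - by rewrite mulr0 sin0 normr0.
have h_abs (th : W -> R) w : #|{ffun 'I_n -> 'I_k.+1}|%:R * `|th w| <=
    A * \sum_x `|lin (@extends n k t) th x|.
  apply: (@seminorm_coef R n k t (fun z => `|z|)) => //.
  - exact: ler_normD.
  - exact: normrN.
  - exact: normr0.
have h_max (th : W -> R) x : #|{ffun 'I_n -> 'I_k.+1}|%:R * `|lin (@extends n k t) th x| <=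
    A * \sum_x `|lin (@extends n k t) th x|.
  apply: (hmax (fun z => `|z|)) => //.
  - exact: ler_normD.
  - exact: normrN.
  - exact: normr0.
have hE (w : W) : p * \sum_x (extends w x)%:R = (M * k.+1 ^ (t - #|supp (val w)|))%N%:R.
  rewrite sum_extends /p -/Q /N !natrM !natrX.
  have wt := low_weight_le w.
  have kR : (k.+1%:R : R) != 0 by rewrite pnatr_eq0.
  have e : (k.+1%:R : R) ^+ t * k.+1%:R ^+ (n - #|supp (val w)|) =
      Q * k.+1%:R ^+ (t - #|supp (val w)|).
    by rewrite /Q -!exprD !addnBA // ?(leq_trans wt) // addnC.
  transitivity (M%:R * ((k.+1%:R : R) ^+ t * k.+1%:R ^+ (n - #|supp (val w)|)) / Q).
    by ring.
  rewrite e; move: (Q) Q0 (k.+1%:R ^+ _) => b b0 c; field; exact: lt0r_neq0.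
have B0 : (0 < #|{ffun 'I_n -> 'I_k.+1}|)%N by rewrite card_word expn_gt0.
have hd (u : W) : 0 < (word_sqnorm (val u) : R) <= #|{ffun 'I_n -> 'I_k.+1}|%:R.
  by rewrite word_sqnorm_gt0 word_sqnorm_le.
have := local_limit hE p01 A1 W0 B0 (@lin_sqr R n k t) hd h_sin h_abs h_max hs2.
rewrite prob_hit_count // gauss_mass_words // -/N eQ.
rewrite -/(r) -/Y.
set cn : R := (num_orthogonal_arrays _ _ _ _)%:R.
set a := _ `^ (- _); set b := (2 * pi * p * (1 - p)) `^ _.
set sg := Num.sqrt (p * (1 - p) * Q).
have a0 : 0 < a by rewrite powR_gt0 // ltr0n.
have b0 : 0 < b by rewrite powR_gt0 // !mulr_gt0 ?pi_gt0.
have x0 : 0 < p ^+ N by rewrite exprn_gt0.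
have y0 : 0 < (1 - p) ^+ (k.+1 ^ n - N) by rewrite exprn_gt0.
move: (p ^+ N) ((1 - p) ^+ _) x0 y0 => x y x0 y0 hloc.
exists (cn * (x * y) / (a / b) - 1); split.
  by field; rewrite !lt0r_neq0.
have ab0 : 0 < a / b by rewrite divr_gt0.
have -> : cn * (x * y) / (a / b) - 1 = (cn * (x * y) - a / b) / (a / b).
  by rewrite mulrBl divff // lt0r_neq0.
rewrite normrM normfV (gtr0_norm ab0) ler_pdivrMr //.
apply: (le_trans hloc); rewrite ler_wpM2r ?(ltW ab0) //.
have sg2 : sg ^+ 2 = p * (1 - p) * Q by rewrite sqr_sqrtr // mulr_ge0 ?(ltW Q0) // mulr_ge0 ?ltW.
have sg0 : 0 < sg by rewrite sqrtr_gt0 mulr_gt0 // mulr_gt0.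
have sm0 : 0 < Num.sqrt mn by rewrite sqrtr_gt0.
rewrite ler_pdivrMr // mulrAC ler_pdivlMr //.
have Ypos : 0 <= 10 * Y by rewrite mulr_ge0 // (le_trans ler01).
rewrite -ler_sqr ?nnegrE ?(mulr_ge0 Ypos (ltW sm0)) ?(mulr_ge0 (ltW X0) (ltW sg0)) //.
rewrite (exprMn 2 (10 * Y)) (exprMn 2 10 Y) (exprMn 2 X sg) sg2 sqr_sqrtr ?(ltW mn0) //.
have Y2 : 1 <= Y ^+ 2 by exact: exprn_ege1.
have X1 : 1 <= X by apply: le_trans hY; lra.
apply: (@le_trans _ _ (200 * Y ^+ 2 * (mn / 2))).
  by rewrite le_eqVlt; apply/orP; left; apply/eqP; field.
apply: ler_pM s2mn; [by lra | by rewrite divr_ge0 ?(ltW mn0) |].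
by apply: (le_trans hY); rewrite expr2 ler_peMl // ltW.
Qed.
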